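(* Let $a<b$ and let $\sigma:[a,b]\to[0,\infty)$ satisfy $\sigma(a)=\sigma(b)=0$, $\sigma(x)>0$ for all $x\in(a,b)$, and $\sigma$ locally Hölder-$1/2$ continuous on $(a,b)$. Let $Z$ be the $[a,b]$-valued solution of $$dZ_t=\sigma(Z_t)\,dW_t,\qquad Z_0=z\in[a,b],$$ with $W$ a standard Brownian motion, and let $v(t):=\mathrm{Var}[Z_t]$. (i) (Max-variance law.) The generalized Bernoulli distribution $\mathcal{B}(a,b,z)$ is the unique maximum-variance distribution on $[a,b]$ with mean $z$: $$\mathcal{B}(a,b,z)=\operatorname*{argmax}_{\mathcal{L}\in\mathcal{P}(a,b,z)}\mathrm{Var}[\mathcal{L}],$$ where $\mathcal{P}(a,b,z)$ is the set of probability distributions on $[a,b]$ with mean $z$. (ii) (Variance strictly increasing.) $v(t)$ is strictly increasing in $t$ as long as $\mathbb{P}(Z_t\in\{a,b\})<1$.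
   Context: Locally Hölder-$1/2$ continuous on $(a,b)$ means: for every compact $K\subset(a,b)$ there is $C_K$ with $|\sigma(x)-\sigma(y)|\le C_K|x-y|^{1/2}$ for all $x,y\in K$. The generalized Bernoulli distribution $\mathcal{B}(a,b,z)$ is the probability law supported on $\{a,b\}$ with mean $z$, i.e. mass $\frac{z-a}{b-a}$ at $b$ and mass $1-\frac{z-a}{b-a}$ at $a$. The solution $Z$ is the unique absorbed strong solution: it remains constant after first hitting $a$ or $b$. *)

(* Defs.v *)
From HB Require Import structures.
From mathcomp Require Import all_boot all_order all_algebra.
From mathcomp Require Import all_classical all_reals all_analysis.

Set Implicit Arguments.
Unset Strict Implicit.
Unset Printing Implicit Defensive.

Import Order.TTheory GRing.Theory Num.Theory.
Import numFieldNormedType.Exports.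

Local Open Scope classical_set_scope.
Local Open Scope ring_scope.

Section max_variance.
Context {R : realType}.

Definition two_point (a b : R) (x : bool) : R := if x then b else a.

Let measurable_two_point a b : measurable_fun setT (two_point a b).
Proof. by []. Qed.

HB.instance Definition _ a b :=
  isMeasurableFun.Build _ _ _ _ (two_point a b) (measurable_two_point a b).

(* The library's [bernoulli_prob p] degenerates when [p] is outside [0, 1], so
   this is the intended law only for [a < b] and [z] in [a, b]. *)
Definition generalized_bernoulli (a b z : R) : probability R R :=
  distribution (bernoulli_prob ((z - a) / (b - a))) (two_point a b).

Definition laws_with_mean (a b z : R) : set (probability R R) :=
  [set L : probability R R | L `[a, b]%classic = 1%E /\ ('E_L[idfun] = z%:E)%E].

Definition argmax {X : Type} (A : set X) (f : X -> \bar R) : set X :=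
  [set x | A x /\ forall y, A y -> (f y <= f x)%E].

End max_variance.

Definition locally_holder_half {R : realType} (a b : R) (sigma : R -> R) :=
  forall K : set R, compact K -> K `<=` `]a, b[ ->
    exists C : R, forall x y, K x -> K y ->
      `|sigma x - sigma y| <= C * `|x - y| `^ (1 / 2).

(* Processes are indexed by all of [R], but only times [t >= 0] are ever
   constrained or used. *)
Section stochastic_calculus.
Context d (T : measurableType d) {R : realType} (P : probability T R).
Implicit Types (W X : R -> {RV P >-> R}) (H : R -> T -> R).
Implicit Types F : R -> set (set T).

Definition measurable_wrt (G : set (set T)) (f : T -> R) :=
  preimage_set_system setT f measurable `<=` G.

Definition adapted F H := forall t : R, 0 <= t -> measurable_wrt (F t) (H t).

Definition continuous_paths H :=
  forall w : T, {within `[0, +oo[, continuous (H ^~ w)}.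

Definition history W (t : R) : set (set T) :=
  <<s \bigcup_(u in `[0, t]) preimage_set_system setT (W u) measurable >>.

(* Only the [measurable] null sets are added: [P] need not be complete, and
   for complete [P] this is the usual augmentation. *)
Definition brownian_filtration W (t : R) : set (set T) :=
  <<s history W t `|` [set N | measurable N /\ P N = 0%E] >>.

(* The second parameter of [normal_prob] is the standard deviation. *)
Definition brownian_motion W :=
  [/\ forall w, W 0 w = 0,
      continuous_paths W,
      forall s t : R, 0 <= s -> s < t -> forall B : set R, measurable B ->
        P ((W t \- W s) @^-1` B) = normal_prob 0 (Num.sqrt (t - s)) B &
      forall s t : R, 0 <= s -> s < t -> forall A (B : set R),
        history W s A -> measurable B ->
        P (A `&` (W t \- W s) @^-1` B) =
        (P A * P ((W t \- W s)%R @^-1` B))%E].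

(* The process equal to [simple_coef i] on the interval
   ]simple_time i, simple_time i.+1], for i < simple_size, and to 0 elsewhere. *)
Record simple_process F := SimpleProcess {
  simple_size : nat;
  simple_time : nat -> R;
  simple_coef : nat -> T -> R;
  simple_time_ge0 : 0 <= simple_time 0;
  simple_time_le : forall i, simple_time i <= simple_time i.+1;
  simple_coef_bounded : forall i, exists M, forall w, `|simple_coef i w| <= M;
  simple_coef_measurable :
    forall i, measurable_wrt (F (simple_time i)) (simple_coef i) }.

Definition simple_value F (S : simple_process F) (s : R) (w : T) : R :=
  \sum_(i < simple_size S)
    simple_coef S i w * \1_(`]simple_time S i, simple_time S i.+1]%classic) s.

Definition simple_integral F W (S : simple_process F) (t : R) (w : T) : R :=
  \sum_(i < simple_size S)
    simple_coef S i w * (W (Num.min (simple_time S i.+1) t) w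
                         - W (Num.min (simple_time S i) t) w).

(* [I] is the stochastic integral process t |-> \int_0^t H_s dW_s, for [H] in
   the class of adapted processes with almost surely square-integrable paths:
   on every [0, t], [H] is approximated by simple processes, in L^2(0, t) in
   probability, whose elementary integrals converge to [I] uniformly in
   probability.  For [I] with continuous paths, the limit does not depend on the
   approximating sequence up to indistinguishability, so an existential over
   it is enough. *)
Definition ito_integral F W H (I : R -> T -> R) :=
  [/\ adapted F H,
      measurable_fun (`[0, +oo[ `*` setT : set (measurableTypeR R * T))
        (fun p => H p.1 p.2),
      {ae P, forall w, forall t : R, 0 <= t ->
        (\int[lebesgue_measure]_(s in `[0%R, t]) (H s w ^+ 2)%:E < +oo)%E},
      continuous_paths I &
      forall t : R, 0 <= t -> exists S : nat -> simple_process F,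
        forall e : R, 0 < e ->
          (P [set w | (e%:E < \int[lebesgue_measure]_(s in `[0%R, t])
                ((simple_value (S n) s w - H s w) ^+ 2)%:E)%E]
             @[n --> \oo] --> 0%E) /\
          (P [set w | exists2 s : R, s \in `[0, t] &
                e < `|simple_integral W (S n) s w - I s w|]
             @[n --> \oo] --> 0%E)].

(* The equation is Z_t = z + \int_0^t sigma(Z_s) dW_s; "strong" means adapted to
   the augmented filtration of the driving Brownian motion. *)
Definition absorbed_strong_solution W (a b : R) (sigma : R -> R) (z : R)
    (Z : R -> {RV P >-> R}) :=
  [/\ forall (t : R) w, 0 <= t -> Z t w \in `[a, b],
      forall w, Z 0 w = z,
      continuous_paths Z /\ adapted (brownian_filtration W) Z,
      ito_integral (brownian_filtration W) W
        (fun t w => sigma (Z t w)) (fun t w => Z t w - z) &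
      forall (s t : R) w, 0 <= s -> s <= t ->
        Z s w = a \/ Z s w = b -> Z t w = Z s w].

End stochastic_calculus.

(* Main.v *)
Require Import Defs.
From HB Require Import structures.
From mathcomp Require Import all_boot all_order all_algebra.
From mathcomp Require Import all_classical all_reals all_analysis.
From mathcomp Require Import measurable_realfun ring lra.

(** On [[a, b]] the function [(x - a) * (b - x)] is nonnegative, and under a law
    [L] with mean [z] its expectation is [(b - z) * (z - a) - 'V_L[idfun]].  So
    [(b - z) * (z - a)] bounds the variance, and it is attained exactly when the
    function vanishes almost surely, that is when [L] charges only [a] and [b].
    The mean then determines [L], because on [{a, b}] the indicator of any set
    agrees with an affine function.

    For the diffusion, [Z] is a bounded martingale, hence
      ['V_P[Z t] - 'V_P[Z s] = E (Z t - Z s)^2].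
    If this number were [0], orthogonality of increments would give [Z r = Z s]
    almost surely for each [r] in [[s, t]], and continuity would make the paths
    of [Z] constant on [[s, t]].  If a stochastic integral has constant paths on
    [[s, t]] and its integrand is nonnegative and constant in time there, then the
    integrand is [0]; hence [sigma (Z s) = 0] almost surely, so [Z s] lies in
    [{a, b}] almost surely.  The two facts on stochastic integrals that this uses
    are [bounded_ito_increment_mean0] and [constant_ito_integrand0].

    Both are derived from simple processes without stopping times in continuous
    time.  The integral is only a limit in probability of simple integrals, which
    gives no control of moments.  So the step of a simple process is dropped as
    soon as the energy, the integral of its square over [[s, t]], exceeds [K]
    ([exists_controlled_increment]).  The energy up to the end of a step is known
    at its beginning, so the result [X] is still a discrete martingale increment,
    and the isometry gives [E X^2 <= K].  On each path [X] is the increment of the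
    original simple integral up to some time of [[s, t]].  Since simple integrals
    approximate the limit uniformly on [[s, t]] off a small event, [X] inherits
    the bound on the limit there, and on the small event the second moment
    suffices.

    This yields [E (g * (I t - I s)) = 0] for a bounded integral [I] and bounded
    [g] known at time [s]; integrability of the energy of the integrand is not
    presupposed.  If [I] is constant on [[s, t]], then [X] is uniformly small off
    the small event.  The covariation identity
      [E (g * X * (W t - W s)) = E (g * V)],
    where [V] is the integral in time of the truncated simple process, then
    forces [E (g * H s) <= 0] for an integrand constant in time and the indicator
    [g] of the event that [H s] is at most a given bound.  Pairing with
    [W t - W s] rather than with [X] itself keeps everything at the level of
    second moments.

    The Brownian motion enters only through the independence of its increments
    from the augmented past, and through their first two moments. *)

Set Implicit Arguments.
Unset Strict Implicit.
Unset Printing Implicit Defensive.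

Import Order.TTheory GRing.Theory Num.Theory.
Import numFieldNormedType.Exports.

Local Open Scope classical_set_scope.
Local Open Scope ring_scope.

(** * Integrable and square-integrable random variables *)

Section square_integrable.
Context d (T : measurableType d) {R : realType} (P : probability T R).
Implicit Types X Y : T -> R.

Definition L1 X := P.-integrable setT (EFin \o X).
(** The expectation as a real number, so that equations between expectations
    are equations in the field [R]. *)
Definition Ex X : R := \int[P]_w X w.
Definition L2 X := measurable_fun setT X /\ L1 (fun w => X w ^+ 2).

Lemma L1_measurable X : L1 X -> measurable_fun setT X.
Proof. by move=> /measurable_int/measurable_EFinP. Qed.

Lemma L1_le X Y : measurable_fun setT X -> (forall w, `|X w| <= Y w) ->
  L1 Y -> L1 X.
Proof.
move=> mX XY; apply: le_integrable => //; first exact/measurable_EFinP.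
move=> w _ /=; rewrite lee_fin (le_trans (XY w))//; exact: ler_norm.
Qed.

Lemma L1_cst c : L1 (cst c).
Proof. exact: finite_measure_integrable_cst. Qed.

Lemma L1_bounded X M : measurable_fun setT X -> (forall w, `|X w| <= M) -> L1 X.
Proof. by move=> mX XM; apply: (L1_le mX XM); exact: L1_cst. Qed.

Lemma L1D X Y : L1 X -> L1 Y -> L1 (fun w => X w + Y w).
Proof. by move=> lX lY; exact: (integrableD _ lX lY). Qed.

Lemma L1B X Y : L1 X -> L1 Y -> L1 (fun w => X w - Y w).
Proof. by move=> lX lY; exact: (integrableB _ lX lY). Qed.

Lemma L1Z c X : L1 X -> L1 (fun w => c * X w).
Proof. by move=> lX; exact: (integrableZl _ c lX). Qed.

Lemma L1_norm X : L1 X -> L1 (fun w => `|X w|).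
Proof. by move=> lX; exact: integrable_norm. Qed.

Lemma L1_indic (A : set T) : measurable A -> L1 \1_A.
Proof. by move=> mA; exact: integrable_indic. Qed.

Lemma L1_sum n (X : nat -> T -> R) :
  (forall i, (i < n)%N -> L1 (X i)) -> L1 (fun w => \sum_(i < n) X i w).
Proof.
elim: n => [|n IH] lX.
  by under [X in L1 X]eq_fun do rewrite big_ord0; exact: L1_cst.
under [X in L1 X]eq_fun do rewrite big_ord_recr/=.
by apply: L1D; [apply: IH => i ni; apply: lX; exact: ltnW|exact: lX].
Qed.

Lemma Ex_cst c : Ex (cst c) = c.
Proof.
rewrite /Ex Rintegral_cst// (_ : fine _ = 1) ?mulr1//.
exact: (congr1 fine (probability_setT P)).
Qed.

Lemma ExD X Y : L1 X -> L1 Y -> Ex (fun w => X w + Y w) = Ex X + Ex Y.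
Proof. by move=> lX lY; rewrite /Ex RintegralD. Qed.

Lemma ExB X Y : L1 X -> L1 Y -> Ex (fun w => X w - Y w) = Ex X - Ex Y.
Proof. by move=> lX lY; rewrite /Ex RintegralB. Qed.

Lemma ExZ c X : L1 X -> Ex (fun w => c * X w) = c * Ex X.
Proof. by move=> lX; rewrite /Ex RintegralZl. Qed.

Lemma Ex_sum n (X : nat -> T -> R) : (forall i, (i < n)%N -> L1 (X i)) ->
  Ex (fun w => \sum_(i < n) X i w) = \sum_(i < n) Ex (X i).
Proof.
elim: n => [|n IH] lX.
  rewrite big_ord0 (_ : (fun w => _) = cst 0) ?Ex_cst//.
  by apply/funext => w; rewrite big_ord0.
rewrite big_ord_recr/= -IH => [|i ni]; last by apply: lX; exact: ltnW.
rewrite -ExD; [|by apply: L1_sum => i ni; apply: lX; exact: ltnW|exact: lX].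
by congr Ex; apply/funext => w; rewrite big_ord_recr.
Qed.

Lemma Ex_indic (A : set T) : measurable A -> Ex \1_A = fine (P A).
Proof. by move=> mA; rewrite /Ex /Rintegral integral_indic// setIT. Qed.

Lemma Ex_ge0 X : (forall w, 0 <= X w) -> 0 <= Ex X.
Proof. by move=> X0; exact: Rintegral_ge0. Qed.

Lemma Ex_le X Y : L1 X -> L1 Y -> (forall w, X w <= Y w) -> Ex X <= Ex Y.
Proof. by move=> lX lY XY; exact: le_Rintegral. Qed.

Lemma Ex_norm X : L1 X -> `|Ex X| <= Ex (fun w => `|X w|).
Proof. by move=> lX; exact: le_normr_Rintegral. Qed.

Lemma EFin_Ex X : L1 X -> (\int[P]_w (X w)%:E)%E = (Ex X)%:E.
Proof. by move=> lX; rewrite fineK//; exact: integrable_fin_num. Qed.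

Lemma Ex_ae_eq X Y : measurable_fun setT X -> measurable_fun setT Y ->
  {ae P, forall w, X w = Y w} -> Ex X = Ex Y.
Proof.
move=> mX mY XY; congr fine; apply: ae_eq_integral => //.
- exact/measurable_EFinP.
- exact/measurable_EFinP.
- by apply: filterS XY => w /= -> .
Qed.

Lemma Ex_le_ae X Y : L1 X -> L1 Y -> {ae P, forall w, X w <= Y w} ->
  Ex X <= Ex Y.
Proof.
move=> lX lY XY; rewrite -subr_ge0 -ExB//.
have lYX := L1B lY lX.
have mYX := L1_measurable lYX.
rewrite (_ : Ex _ = Ex (fun w => `|Y w - X w|)); first exact: Ex_ge0.
apply: Ex_ae_eq => //; first exact: measurableT_comp.
by apply: filterS XY => w XYw; rewrite ger0_norm// subr_ge0.
Qed.

Lemma Ex_eq0_ae X : L1 X -> (forall w, 0 <= X w) -> Ex X <= 0 ->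
  {ae P, forall w, X w = 0}.
Proof.
move=> lX X0 EX0; have mX := L1_measurable lX.
have EX : Ex X = 0 by apply/eqP; rewrite eq_le EX0 Ex_ge0.
have mEX : measurable_fun setT (EFin \o X) by exact/measurable_EFinP.
move: ((ae_eq_integral_abs P measurableT mEX).1) => /=.
have : (\int[P]_w `|(X w)%:E| = 0)%E.
  by under eq_integral do rewrite gee0_abs ?lee_fin//; rewrite EFin_Ex ?EX.
move=> /[swap] /[apply]; apply: filterS => w /(_ I) /=; by case.
Qed.

Lemma Ex_probability1 (A : set T) : measurable A ->
  {ae P, forall w, A w} -> P A = 1%E.
Proof.
move=> mA; rewrite /almost_everywhere => -[N [mN PN sub]].
apply/eqP; rewrite eq_le probability_le1//=.
rewrite -[X in (X <= _)%E](_ : P (~` N) = 1)%E; last first.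
  by rewrite probability_setC// PN sube0.
by apply: le_measure; rewrite ?inE//; [exact: measurableC|]; apply: subsetCl.
Qed.

Lemma L2_measurable X : L2 X -> measurable_fun setT X. Proof. by case. Qed.

Lemma L2_sqr X : L2 X -> L1 (fun w => X w ^+ 2). Proof. by case. Qed.

Lemma L2M X Y : L2 X -> L2 Y -> L1 (fun w => X w * Y w).
Proof.
move=> [mX lX] [mY lY]; apply: (@L1_le _ (fun w => X w ^+ 2 + Y w ^+ 2)).
- exact: measurable_funM.
- move=> w; have := sqr_ge0 (X w + Y w); have := sqr_ge0 (X w - Y w).
  have := sqr_ge0 (X w); have := sqr_ge0 (Y w).
  rewrite !expr2 ler_norml => *; apply/andP; split; lra.
- exact: L1D.
Qed.

Lemma L2D X Y : L2 X -> L2 Y -> L2 (fun w => X w + Y w).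
Proof.
move=> [mX lX] [mY lY]; split; first exact: measurable_funD.
apply: (@L1_le _ (fun w => 2 * (X w ^+ 2 + Y w ^+ 2))).
- by apply: measurable_funX; exact: measurable_funD.
- move=> w; rewrite ger0_norm ?sqr_ge0//.
  by have := sqr_ge0 (X w - Y w); rewrite !expr2 => ?; lra.
- by apply: L1Z; exact: L1D.
Qed.

Lemma L2Z c X : L2 X -> L2 (fun w => c * X w).
Proof.
move=> [mX lX]; split; first exact: measurable_funM.
by under [X in L1 X]eq_fun do rewrite exprMn; exact: L1Z.
Qed.

Lemma L2B X Y : L2 X -> L2 Y -> L2 (fun w => X w - Y w).
Proof.
move=> lX lY; have := L2D lX (L2Z (-1) lY).
by under [X in L2 X -> _]eq_fun do rewrite mulN1r.
Qed.

Lemma L2_bounded X M : measurable_fun setT X -> (forall w, `|X w| <= M) -> L2 X.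
Proof.
move=> mX XM; split => //; apply: (@L1_bounded _ (M ^+ 2)).
  exact: measurable_funX.
by move=> w; rewrite normrX lerXn2r// nnegrE// (le_trans _ (XM w)).
Qed.

Lemma L2_cst c : L2 (cst c).
Proof. exact: (@L2_bounded _ `|c|). Qed.

Lemma L2_L1 X : L2 X -> L1 X.
Proof.
by move=> lX; have := L2M lX (L2_cst 1); under [X in L1 X -> _]eq_fun do rewrite mulr1.
Qed.

Lemma L2_bounded_mul (g X : T -> R) (M : R) : measurable_fun setT g ->
  (forall w, `|g w| <= M) -> L2 X -> L2 (fun w => g w * X w).
Proof.
move=> mg gM [mX lX]; split; first exact: measurable_funM.
apply: (@L1_le _ (fun w => M ^+ 2 * X w ^+ 2)); last exact: L1Z.
  by apply: measurable_funX; exact: measurable_funM.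
move=> w; rewrite ger0_norm ?sqr_ge0// exprMn ler_wpM2r ?sqr_ge0//.
by rewrite -[leLHS]ger0_norm ?sqr_ge0// normrX lerXn2r// nnegrE// (le_trans _ (gM w)).
Qed.

Lemma expectationEx X : L1 X -> ('E_P[X] = (Ex X)%:E)%E.
Proof. by move=> lX; rewrite unlock -EFin_Ex. Qed.

Lemma varianceEx X : L2 X ->
  ('V_P[X] = (Ex (fun w => X w ^+ 2) - (Ex X) ^+ 2)%:E)%E.
Proof.
move=> lX; have l1 := L2_L1 lX; have lX2 := L2_sqr lX.
rewrite /variance unlock (expectationEx l1)/=.
have L : L2 (fun w => X w - Ex X) by exact: (L2B lX (L2_cst _)).
rewrite expectationEx; last exact: (L2_sqr L).
congr EFin; set c := Ex X.
rewrite (_ : (_ * _)%R = (fun w => X w ^+ 2 + (- (2 * c) * X w + c ^+ 2))); last first.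
  by apply/funext => w /=; rewrite !fctE /=; ring.
rewrite ExD//; last by apply: L1D (L1_cst _); exact: L1Z.
by rewrite ExD ?Ex_cst ?ExZ//; [rewrite -/c; ring|exact: L1Z|exact: L1_cst].
Qed.

Lemma L1_ae_eq X Y :
  measurable_fun setT X -> L1 Y -> {ae P, forall w, X w = Y w} -> L1 X.
Proof.
move=> mX lY XY; have mY := L1_measurable lY.
apply/integrableP; split; first exact/measurable_EFinP.
have /integrableP[_] := lY; apply: le_lt_trans.
rewrite le_eqVlt; apply/orP; left; apply/eqP; apply: ae_eq_integral => //.
- by apply: measurableT_comp => //; exact/measurable_EFinP.
- by apply: measurableT_comp => //; exact/measurable_EFinP.
- by apply: filterS XY => w /= -> .
Qed.

Lemma ae_full_measure (A : set T) :
  measurable A -> P A = 1%E -> {ae P, forall w, A w}.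
Proof.
move=> mA PA; exists (~` A); split => //; first exact: measurableC.
by rewrite probability_setC// PA subee.
Qed.

End square_integrable.

(** * The law of maximal variance *)

Section max_variance_law.
Context {R : realType}.
Variables (a b z : R).
Hypotheses (hab : a < b) (hz : z \in `[a, b]).
Implicit Type L : probability R R.

Let q (x : R) := (x - a) * (b - x).

Lemma L1_on_support L (f : R -> R) (M : R) : L `[a, b]%classic = 1%E ->
  measurable_fun setT f -> (forall x, a <= x -> x <= b -> `|f x| <= M) ->
  L1 L f.
Proof.
move=> Lab mf fM.
apply: (@L1_ae_eq _ _ _ L f (fun x => f x * \1_(`[a, b]) x)) => //.
  apply: (@L1_bounded _ _ _ _ _ `|M|).
    by apply: measurable_funM => //; exact: measurable_indic.
  move=> x; rewrite indicE; case: (boolP (x \in _)) => [|_].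
    rewrite inE/= in_itv/= => /andP[ax xb].
    by rewrite mulr1 (le_trans (fM x ax xb))// ler_norm.
  by rewrite mulr0 normr0.
apply: filterS (ae_full_measure (measurable_itv _) Lab) => x xab.
by rewrite indicE mem_set// mulr1.
Qed.

Let mq : measurable_fun setT q.
Proof. by apply: measurable_funM; apply: measurable_funB. Qed.

Let L1_q L : L `[a, b]%classic = 1%E -> L1 L q.
Proof.
move=> Lab; apply: (@L1_on_support L q ((b - a) * (b - a)) Lab mq) => x ax xb.
by rewrite normrM ler_pM//; rewrite ger0_norm; lra.
Qed.

Let L2_id L : L `[a, b]%classic = 1%E -> L2 L idfun.
Proof.
move=> Lab; split; first exact: measurable_id.
apply: (@L1_on_support L (fun x => x ^+ 2) ((`|a| + `|b|) ^+ 2) Lab).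
  exact: exprn_measurable.
move=> x ax xb; rewrite normrX lerXn2r ?nnegrE ?addr_ge0//=.
rewrite ler_norml; apply/andP; split.
  by have := ler_norm (- a); rewrite normrN; have := normr_ge0 b; lra.
by have := ler_norm b; have := normr_ge0 a; lra.
Qed.

Lemma law_mean L : laws_with_mean a b z L -> Ex L idfun = z.
Proof.
by move=> [Lab Lz]; move: Lz; rewrite (expectationEx (L2_L1 (L2_id Lab))) => -[].
Qed.

Lemma law_variance L : laws_with_mean a b z L ->
  ('V_L[idfun] = ((b - z) * (z - a) - Ex L q)%:E)%E.
Proof.
move=> LL; have [Lab _] := LL; have l2 := L2_id Lab; have l1 := L2_L1 l2.
rewrite varianceEx// (law_mean LL); congr EFin.
rewrite (_ : Ex L q = (a + b) * z - a * b - Ex L (fun x => x ^+ 2)); first by ring.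
rewrite -{1}(law_mean LL) -(ExZ _ l1) -(Ex_cst L (a * b)).
rewrite -(ExB (L1Z _ l1) (L1_cst L (a * b))) -ExB.
- by congr Ex; apply/funext => x; rewrite /q /=; ring.
- by apply: L1B; [exact: L1Z|exact: L1_cst].
- exact: L2_sqr.
Qed.

Let q_ge0_ae L : L `[a, b]%classic = 1%E -> {ae L, forall x, 0 <= q x}.
Proof.
move=> Lab; apply: filterS (ae_full_measure (measurable_itv _) Lab) => x /=.
by rewrite in_itv/= => /andP[ax xb]; rewrite /q mulr_ge0// subr_ge0.
Qed.

(** On [{a, b}] the indicator of [A] is the affine function through its values at
    [a] and [b], so [L A] is the value of that function at the mean. *)
Lemma two_point_law_unique L : laws_with_mean a b z L ->
  {ae L, forall x, x = a \/ x = b} ->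
  forall A : set R, measurable A ->
    L A = (\1_A a + (\1_A b - \1_A a) * ((z - a) / (b - a)))%:E.
Proof.
move=> LL xab A mA; have [Lab _] := LL; have l1 := L2_L1 (L2_id Lab).
have lx : L1 L (fun x => x - a) by exact: (L1B l1 (L1_cst L a)).
have mx := L1_measurable lx.
rewrite -[LHS](@fineK _ (L A)) ?fin_num_measure// -(Ex_indic _ mA).
have aff (u v : R) : Ex L (fun x => u + v * (x - a)) = u + v * (z - a).
  rewrite (ExD (L1_cst L u) (L1Z v lx)) (ExZ v lx) (ExB l1 (L1_cst L a)) !Ex_cst.
  by rewrite (law_mean LL).
set k := (\1_A b - \1_A a) / (b - a) : R.
rewrite (@Ex_ae_eq _ _ _ L \1_A (fun x => \1_A a + k * (x - a))).
- by rewrite aff /k mulrAC mulrA.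
- exact: measurable_indic.
- by apply: measurable_funD => //; exact: measurable_funM.
- apply: filterS xab => x [->|->]; first by rewrite subrr mulr0 addr0.
  by rewrite /k divfK ?subr_eq0 ?gt_eqF//; ring.
Qed.

Let p : R := (z - a) / (b - a).

Let p01 : 0 <= p <= 1.
Proof.
move: hz; rewrite in_itv/= => /andP[az zb].
rewrite /p divr_ge0 ?subr_ge0 ?(ltW hab)//=.
by rewrite ler_pdivrMr ?subr_gt0// mul1r lerD2r.
Qed.

Lemma generalized_bernoulli_support :
  {ae generalized_bernoulli a b z, forall x, x = a \/ x = b}.
Proof.
have mab : measurable [set a; b] by apply: measurableU; exact: measurable_set1.
apply: filterS (ae_full_measure mab _) => //.
rewrite /generalized_bernoulli /distribution /= /pushforward.
rewrite (_ : _ @^-1` _ = setT) ?probability_setT//.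
by apply/seteqP; split => // -[] _; [right|left].
Qed.

Lemma generalized_bernoulli_law :
  laws_with_mean a b z (generalized_bernoulli a b z).
Proof.
have supp : generalized_bernoulli a b z `[a, b]%classic = 1%E.
  apply: Ex_probability1 => //.
  apply: filterS generalized_bernoulli_support => x /=.
  by case=> ->; rewrite in_itv/= lexx ltW.
split => //; rewrite (expectationEx (L2_L1 (L2_id supp))); congr EFin.
have l1 := L2_L1 (L2_id supp).
have lxa := L1B l1 (L1_cst (generalized_bernoulli a b z) a).
have : Ex (generalized_bernoulli a b z) (fun x => x - a) = z - a.
  rewrite /Ex /Rintegral /generalized_bernoulli integral_distribution//; first last.
  - apply: (@L1_bounded _ _ _ (bernoulli_prob p) (fun y => two_point a b y - a) (b - a)) => //.
    have ba : 0 <= b - a by rewrite subr_ge0 ltW.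
    by move=> [] /=; rewrite /two_point ?(ger0_norm ba)// subrr normr0.
  - by apply/measurable_EFinP; exact: L1_measurable lxa.
  rewrite integral_bernoulli_prob//.
    rewrite /comp /two_point subrr -!EFinM -EFinD /fine mulr0 addr0 divfK//.
    by rewrite subr_eq0 gt_eqF.
  by move=> [] /=; rewrite lee_fin ?subrr// subr_ge0 ltW.
by rewrite (ExB l1 (L1_cst _ a)) Ex_cst => /addIr.
Qed.

Lemma generalized_bernoulli_defect0 : Ex (generalized_bernoulli a b z) q = 0.
Proof.
rewrite (@Ex_ae_eq _ _ _ _ q (cst 0)) ?Ex_cst//.
apply: filterS generalized_bernoulli_support => x /= [] ->; rewrite /q subrr.
  by rewrite mul0r.
by rewrite mulr0.
Qed.

Lemma max_variance_law :
  argmax (laws_with_mean a b z) (fun L => 'V_L[idfun]) (generalized_bernoulli a b z) /\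
  forall L : probability R R,
     argmax (laws_with_mean a b z) (fun L' => 'V_L'[idfun]) L ->
     forall A : set R, measurable A -> L A = generalized_bernoulli a b z A.
Proof.
have Bl := generalized_bernoulli_law.
have VB := law_variance Bl; rewrite generalized_bernoulli_defect0 subr0 in VB.
split; first split => //.
  move=> L LL; rewrite VB (law_variance LL) lee_fin gerBl.
  have [Lab _] := LL; rewrite -(Ex_cst L 0).
  by apply: Ex_le_ae (q_ge0_ae Lab); [exact: L1_cst|exact: L1_q].
move=> L [LL Lmax] A mA; have [Lab _] := LL.
have Eq0 : Ex L q <= 0.
  by have := Lmax _ Bl; rewrite VB (law_variance LL) lee_fin; lra.
have q0 : {ae L, forall x, `|q x| = 0}.
  apply: Ex_eq0_ae; first exact: L1_norm (L1_q Lab).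
    by move=> x; exact: normr_ge0.
  rewrite (@Ex_ae_eq _ _ _ L _ q)//; first exact: measurableT_comp.
  by apply: filterS (q_ge0_ae Lab) => x; exact: ger0_norm.
have supp : {ae L, forall x, x = a \/ x = b}.
  apply: filterS q0 => x /eqP; rewrite normr_eq0 /q mulf_eq0 !subr_eq0.
  by move=> /orP[/eqP|/eqP]; [left|right].
rewrite (two_point_law_unique LL supp mA).
by rewrite (two_point_law_unique Bl generalized_bernoulli_support mA).
Qed.

End max_variance_law.

(** * Expectation of a product of independent variables *)

Section independence.
Context d (T : measurableType d) {R : realType} (P : probability T R).

(** Agreement on rectangles makes the joint law the product of the marginal laws;
    then Tonelli applies. *)
Lemma indep_joint (X Y : {RV P >-> R}) :
  (forall A B : set R, measurable A -> measurable B ->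
    P (X @^-1` A `&` Y @^-1` B) = (P (X @^-1` A) * P (Y @^-1` B))%E) ->
  forall f : R * R -> \bar R, measurable_fun setT f -> (forall z, 0 <= f z)%E ->
  (\int[P]_w f (X w, Y w) = \int[P]_w \int[P]_w' f (X w, Y w'))%E.
Proof.
move=> XY f mf f0.
have mXY : measurable_fun setT (fun w => (X w, Y w)).
  exact: measurable_fun_pair.
pose XYm : {mfun T >-> _} := mfun_Sub (mem_set mXY).
transitivity (\int[distribution P XYm]_z f z)%E.
  by rewrite ge0_integral_pushforward.
transitivity (\int[(distribution P X \x distribution P Y)%E]_z f z)%E.
  apply/esym; apply: eq_measure_integral => /= A mA _.
  by apply: product_measure_unique => //= B C mB mC; rewrite /pushforward -XY.
rewrite fubini_tonelli1// ge0_integral_pushforward//; last first.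
- by move=> x _; apply: integral_ge0 => y _; exact: f0.
- exact: measurable_fun_fubini_tonelli_F.
apply: eq_integral => w _; rewrite /= /fubini_F/=.
rewrite ge0_integral_pushforward//.
exact: measurableT_comp.
Qed.

Let indep_ge0 (X Y : {RV P >-> R}) (p q : R -> R) :
  (forall A B : set R, measurable A -> measurable B ->
    P (X @^-1` A `&` Y @^-1` B) = (P (X @^-1` A) * P (Y @^-1` B))%E) ->
  measurable_fun setT p -> measurable_fun setT q ->
  (forall x, 0 <= p x) -> (forall x, 0 <= q x) ->
  L1 P (p \o X) -> L1 P (q \o Y) ->
  L1 P (fun w => p (X w) * q (Y w)) /\
  Ex P (fun w => p (X w) * q (Y w)) = Ex P (p \o X) * Ex P (q \o Y).
Proof.
move=> XY mp mq p0 q0 lX lY.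
have mpq : measurable_fun setT (fun z : R * R => p z.1 * q z.2).
  by apply: measurable_funM; exact: measurableT_comp.
have E : (\int[P]_w (p (X w) * q (Y w))%:E =
          (Ex P (p \o X) * Ex P (q \o Y))%:E)%E.
  rewrite (indep_joint XY (f := fun z => (p z.1 * q z.2)%:E))/=; last 2 first.
  - exact/measurable_EFinP.
  - by move=> z; rewrite lee_fin mulr_ge0.
  rewrite EFinM -(EFin_Ex lX) -integralZr//.
  apply: eq_integral => w _; rewrite -(EFin_Ex lY) -integralZl//.
have mpqw : measurable_fun setT (fun w => p (X w) * q (Y w)).
  by apply: measurable_funM; exact: measurableT_comp.
split; last by rewrite /Ex /Rintegral E.
apply/integrableP; split; first exact/measurable_EFinP.
under eq_integral do rewrite /= ger0_norm ?mulr_ge0//.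
by rewrite E ltry.
Qed.

(** Split both factors into positive and negative parts. *)
Lemma indep_mul (X Y : T -> R) :
  L1 P X -> L1 P Y ->
  (forall A B : set R, measurable A -> measurable B ->
    P (X @^-1` A `&` Y @^-1` B) = (P (X @^-1` A) * P (Y @^-1` B))%E) ->
  L1 P (fun w => X w * Y w) /\ Ex P (fun w => X w * Y w) = Ex P X * Ex P Y.
Proof.
move=> lX lY XY.
have mX := L1_measurable lX; have mY := L1_measurable lY.
pose X' : {RV P >-> R} := mfun_Sub (mem_set mX).
pose Y' : {RV P >-> R} := mfun_Sub (mem_set mY).
pose pos (x : R) := Num.max x 0; pose neg (x : R) := Num.max (- x) 0.
have mpos : measurable_fun setT pos by exact: measurable_maxr.
have mneg : measurable_fun setT neg by apply: measurable_maxr => //; exact: measurableT_comp.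
have pos0 x : 0 <= pos x by rewrite le_max lexx orbT.
have neg0 x : 0 <= neg x by rewrite le_max lexx orbT.
have posneg x : pos x - neg x = x.
  rewrite /pos /neg; case: (leP x 0) => x0.
    by rewrite max_l ?oppr_ge0// sub0r opprK.
  by rewrite max_r ?subr0// oppr_le0 ltW.
have lepos x : pos x <= `|x| by rewrite ge_max ler_norm/=.
have leneg x : neg x <= `|x| by rewrite ge_max normr_ge0 -normrN ler_norm.
have lp Z : L1 P Z -> L1 P (pos \o Z).
  move=> lZ; apply: (L1_le _ _ (L1_norm lZ)).
    by apply: measurableT_comp => //; exact: L1_measurable lZ.
  by move=> w /=; rewrite ger0_norm.
have ln Z : L1 P Z -> L1 P (neg \o Z).
  move=> lZ; apply: (L1_le _ _ (L1_norm lZ)).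
    by apply: measurableT_comp => //; exact: L1_measurable lZ.
  by move=> w /=; rewrite ger0_norm.
have XY' : forall A B : set R, measurable A -> measurable B ->
    P (X' @^-1` A `&` Y' @^-1` B) = (P (X' @^-1` A) * P (Y' @^-1` B))%E by [].
have [l1 e1] := indep_ge0 XY' mpos mpos pos0 pos0 (lp _ lX) (lp _ lY).
have [l2 e2] := indep_ge0 XY' mpos mneg pos0 neg0 (lp _ lX) (ln _ lY).
have [l3 e3] := indep_ge0 XY' mneg mpos neg0 pos0 (ln _ lX) (lp _ lY).
have [l4 e4] := indep_ge0 XY' mneg mneg neg0 neg0 (ln _ lX) (ln _ lY).
have XYE : (fun w => X w * Y w) = (fun w => (pos (X' w) * pos (Y' w)
    - pos (X' w) * neg (Y' w)) - (neg (X' w) * pos (Y' w) - neg (X' w) * neg (Y' w))).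
  by apply/funext => w /=; rewrite -{1}(posneg (X w)) -{1}(posneg (Y w)); ring.
have l12 := L1B l1 l2; have l34 := L1B l3 l4.
split; first by rewrite XYE; exact: L1B.
rewrite XYE ExB// ExB// ExB// e1 e2 e3 e4.
have -> : Ex P X = Ex P (pos \o X') - Ex P (neg \o X').
  by rewrite -ExB; [congr Ex; apply/funext => w /=; rewrite posneg|exact: lp|exact: ln].
have -> : Ex P Y = Ex P (pos \o Y') - Ex P (neg \o Y').
  by rewrite -ExB; [congr Ex; apply/funext => w /=; rewrite posneg|exact: lp|exact: ln].
ring.
Qed.

End independence.

(** * Moments of the centred normal law *)

Section gaussian.
Context {R : realType}.
Notation mu := (@lebesgue_measure R).
Variable s : R.
Hypothesis s0 : s != 0.
Local Notation phi := (normal_pdf 0 s).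

Lemma integral_normal_prob (f : R -> \bar R) :
  measurable_fun setT f -> (forall x, 0 <= f x)%E ->
  (\int[normal_prob 0 s]_x f x = \int[mu]_x (f x * (phi x)%:E))%E.
Proof.
move=> mf f0; have dom := normal_prob_dominates 0 s.
rewrite -(Radon_Nikodym_SigmaFinite.change_of_variables dom)//.
apply: ae_eq_integral => //.
- apply: emeasurable_funM => //.
  exact: measurable_int (Radon_Nikodym_SigmaFinite.f_integrable dom).
- apply: emeasurable_funM => //; apply/measurable_EFinP.
  exact: measurable_normal_pdf.
- apply: ae_eqe_mul2l; apply: integral_ae_eq => //.
  + exact: Radon_Nikodym_SigmaFinite.f_integrable dom.
  + by apply/measurable_EFinP; exact: measurable_normal_pdf.
  + by move=> E _ mE; rewrite -Radon_Nikodym_SigmaFinite.f_integral.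
Qed.

Lemma normal_pdf_even x : phi (- x) = phi x.
Proof. by rewrite normal_pdfE// /normal_fun !subr0 sqrrN. Qed.

Lemma derive1_normal_pdf (x : R) : is_derive x (1 : R) phi (- (x * phi x / s ^+ 2)).
Proof.
rewrite normal_pdfE//.
have -> : (fun x => normal_peak s * normal_fun 0 s x) = 
  (fun x : R => normal_peak s * expR (- (x * x / (s ^+ 2 *+ 2)))).
  by apply/funext => y; rewrite /normal_fun subr0 mulNr expr2.
apply: is_derive_eq.
rewrite /normal_fun subr0 /GRing.scale/= expr2 mulNr.
set E := expR _.
field.
by rewrite s0.
Qed.

Lemma cvg_normal_pdf : phi x @[x --> +oo] --> (0 : R).
Proof.
rewrite normal_pdfE// -[X in _ --> X](mulr0 (normal_peak s)).
apply: cvgM; first exact: cvg_cst.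
have c0 : 0 < (s ^+ 2 *+ 2)^-1 by rewrite invr_gt0 pmulrn_lgt0// exprn_even_gt0.
rewrite (_ : normal_fun 0 s = (fun x => expR (- x)) \o
    (fun x : R => (s ^+ 2 *+ 2)^-1 * x ^+ 2)); last first.
  by apply/funext => x /=; rewrite /normal_fun subr0 mulNr mulrC.
apply: (cvg_comp (fun x : R => (s ^+ 2 *+ 2)^-1 * x ^+ 2) (fun x => expR (- x)));
  last exact: cvgr_expR.
by apply/gt0_cvgMry => //; exact: cvgr_expr2.
Qed.

(** [- s ^+ 2 * normal_pdf 0 s] is a primitive of the integrand. *)
Lemma tail_first_moment a : 0 <= a ->
  (\int[mu]_(x in `[a, +oo[) (x * phi x)%:E = (s ^+ 2 * phi a)%:E)%E.
Proof.
move=> a0.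
have cphi : continuous phi by exact: continuous_normal_pdf.
have cF : continuous (fun x => - (s ^+ 2) * phi x).
  by move=> x; apply: cvgM; [exact: cvg_cst|exact: cphi].
have dF (x : R) : is_derive x (1 : R) (fun x => - (s ^+ 2) * phi x) (x * phi x).
  have d := derive1_normal_pdf x; apply: is_derive_eq.
  by rewrite /GRing.scale/=; field.
rewrite (@ge0_continuous_FTC2y _ _ (fun x => - (s ^+ 2) * phi x) _ 0).
- by rewrite -EFinB sub0r mulNr opprK.
- by move=> x ax; rewrite mulr_ge0 ?normal_pdf_ge0// (le_trans a0).
- apply: continuous_subspaceT => x.
  by apply: cvgM; [exact: cvg_id|exact: cphi].
- rewrite -[X in _ --> X](mulr0 (- (s ^+ 2))).
  by apply: cvgM; [exact: cvg_cst|exact: cvg_normal_pdf].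
- by move=> x _; case: (dF x).
- by apply: cvg_at_right_filter; exact: cF.
- by move=> x _; rewrite derive1E; case: (dF x).
Qed.

Lemma integral_vanishing_left (f : R -> R) : measurable_fun setT f ->
  (forall x, x < 0 -> f x = 0) ->
  (\int[mu]_x (f x)%:E = \int[mu]_(x in `[0%R, +oo[) (f x)%:E)%E.
Proof.
move=> mf f0; rewrite [RHS]integral_mkcond; apply: eq_integral => x _.
rewrite patchE; case: ifPn => //; rewrite notin_setE/= in_itv/= andbT.
by move=> /negP; rewrite -ltNge => /f0 ->.
Qed.

Let mphi : measurable_fun setT phi. Proof. exact: measurable_normal_pdf. Qed.

Lemma normal_half_mass : 
  (\int[mu]_(x in `[0%R, +oo[) (phi x)%:E = (2^-1)%:E)%E.
Proof.
have := integral_normal_pdf 0 s.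
rewrite ge0_symfun_integralT//; last 3 first.
- by move=> x; rewrite normal_pdf_ge0.
- exact: continuous_normal_pdf.
- by move=> x /=; rewrite normal_pdf_even.
rewrite -set_itvcy.
by move=> /esym/eqP; rewrite -eqe_pdivrMl// mule1 => /eqP <-.
Qed.

(** Write one factor [x] as the length of [[0, x]] and exchange the order of
    integration: what remains is the integral of the tail first moments. *)
Lemma half_second_moment :
  (\int[mu]_(x in `[0%R, +oo[) (x ^+ 2 * phi x)%:E = (s ^+ 2 / 2)%:E)%E.
Proof.
pose f (z : R * R) : \bar R :=
  (if (0 <= z.2) && (z.2 <= z.1) then z.1 * phi z.1 else 0)%:E.
have mf : measurable_fun setT f.
  apply/measurable_EFinP; apply: measurable_fun_ifT => //.
  - by apply: measurable_and; apply: measurable_fun_ler.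
  - by apply: measurable_funM => //; exact: measurableT_comp.
have f0 z : (0 <= f z)%E.
  rewrite /f lee_fin; case: ifP => // /andP[z2 z1].
  by rewrite mulr_ge0 ?normal_pdf_ge0// (le_trans z2).
have := @fubini_tonelli _ _ _ _ _ mu mu f mf f0.
set L := LHS; have -> : L = (\int[mu]_(x in `[0%R, +oo[) (x ^+ 2 * phi x)%:E)%E.
  rewrite [RHS]integral_mkcond; apply: eq_integral => x _ /=.
  transitivity (\int[mu]_(y in `[0%R, x]) (x * phi x)%:E)%E.
    rewrite [RHS]integral_mkcond; apply: eq_integral => y _ /=.
    rewrite patchE /f/=; case: ifPn.
      by move=> yx; rewrite mem_set//= in_itv.
    by move=> yx; rewrite memNset//= in_itv/=; apply/negP.
  rewrite integral_cst//= lebesgue_measure_itv/= lte_fin patchE.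
  case: ifPn => x0.
    rewrite mem_set/= ?in_itv/= ?ltW// EFinN sube0 -EFinM; congr EFin; ring.
  rewrite mule0; case: ifPn => //; rewrite inE/= in_itv/= andbT => x00.
  by move: x0; rewrite -leNgt => x0; rewrite (@le_anti _ _ x 0) ?x0// expr2 !mul0r.
move=> ->.
transitivity (\int[mu]_(x in `[0%R, +oo[) ((s ^+ 2)%:E * (phi x)%:E))%E.
  rewrite [RHS]integral_mkcond; apply: eq_integral => y _ /=.
  rewrite patchE; case: ifPn.
    rewrite inE/= in_itv/= andbT => y0.
    rewrite -EFinM -tail_first_moment// [RHS]integral_mkcond.
    apply: eq_integral => x _; rewrite patchE /f/= y0/=.
    case: ifPn => yx; first by rewrite mem_set//= in_itv/= yx.
    by rewrite memNset//= in_itv/= andbT; apply/negP.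
  rewrite notin_setE/= in_itv/= andbT => /negP y0.
  by rewrite integral0_eq// => x _; rewrite /f/= (negbTE y0).
rewrite ge0_integralZl//.
- by rewrite normal_half_mass -EFinM.
- by apply/measurable_EFinP; exact: measurable_funTS.
- by move=> x _; rewrite lee_fin normal_pdf_ge0.
- by rewrite lee_fin sqr_ge0.
Qed.


Context d (T : measurableType d) (P : probability T R).

(** The mean vanishes because positive and negative part have the same
    expectation, by symmetry of the density. *)
Lemma normal_law_moments (X : T -> R) : measurable_fun setT X ->
  (forall B : set R, measurable B -> P (X @^-1` B) = normal_prob 0 s B) ->
  [/\ L2 P X, Ex P X = 0 & Ex P (fun w => X w ^+ 2) = s ^+ 2].
Proof.
move=> mX law; have mX' : @measurable_fun _ _ T (measurableTypeR R) setT X by exact: mX.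
pose X' : {RV P >-> measurableTypeR R} :=
  @mfun_Sub _ _ T (measurableTypeR R) X (mem_set mX').
have tr (f : R -> R) : measurable_fun setT f -> (forall x, 0 <= f x) ->
    (\int[P]_w (f (X w))%:E = \int[mu]_x (f x * phi x)%:E)%E.
  move=> mf f0; under [RHS]eq_integral do rewrite EFinM.
  rewrite -integral_normal_prob; last 2 first.
  - exact/measurable_EFinP.
  - by move=> x; rewrite lee_fin.
  transitivity (\int[distribution P X']_x (f x)%:E)%E.
    rewrite ge0_integral_pushforward//.
      by apply/measurable_EFinP; exact: mf.
    by move=> x _; rewrite lee_fin.
  by apply: eq_measure_integral => A mA _; exact: law.
have evensq x : x ^+ 2 * phi x = (- x) ^+ 2 * phi (- x).
  by rewrite normal_pdf_even sqrrN.
have E2 : (\int[P]_w (X w ^+ 2)%:E = (s ^+ 2)%:E)%E.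
  rewrite (tr (fun x => x ^+ 2))//; last by move=> x; exact: sqr_ge0.
  rewrite ge0_symfun_integralT//; last 2 first.
  - by move=> x; rewrite mulr_ge0 ?sqr_ge0 ?normal_pdf_ge0.
  - move=> x; apply: cvgM; last exact: continuous_normal_pdf.
    exact: exprn_continuous.
  rewrite -set_itvcy half_second_moment -EFinM mulrCA divff ?mulr1//.
have lX : L2 P X.
  split => //; apply/integrableP; split.
    by apply/measurable_EFinP; exact: measurable_funX.
  under eq_integral do rewrite /= ger0_norm ?sqr_ge0//.
  by rewrite E2 ltry.
split => //; last by rewrite /Ex /Rintegral E2.
pose p (x : R) := Num.max x 0; pose q (x : R) := Num.max (- x) 0.
have mp : measurable_fun setT p by exact: measurable_maxr.
have mq : measurable_fun setT q.
  by apply: measurable_maxr => //; exact: measurableT_comp.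
have p0 x : 0 <= p x by rewrite le_max lexx orbT.
have q0 x : 0 <= q x by rewrite le_max lexx orbT.
have cp : continuous (fun x => p x * phi x).
  move=> x; apply: cvgM; last exact: continuous_normal_pdf.
  by apply: continuous_max; [exact: cvg_id|exact: cvg_cst].
have cq : continuous (fun x => q x * phi x).
  move=> x; apply: cvgM; last exact: continuous_normal_pdf.
  by apply: continuous_max; [apply: cvgN; exact: cvg_id|exact: cvg_cst].
have pq : (\int[P]_w (p (X w))%:E = \int[P]_w (q (X w))%:E)%E.
  rewrite !tr//.
  rewrite integral_vanishing_left; last 2 first.
  - by apply: measurable_funM.
  - by move=> x x0; rewrite /p max_r ?mul0r// ltW.
  have -> : (\int[mu]_x (q x * phi x)%:E =
      \int[mu]_(x in `]-oo, 0%R]) (q x * phi x)%:E)%E.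
    rewrite [RHS]integral_mkcond; apply: eq_integral => x _; rewrite patchE.
    case: ifPn => //; rewrite notin_setE/= in_itv/= => /negP; rewrite -ltNge => x0.
    by rewrite /q max_r ?mul0r// oppr_le0 ltW.
  rewrite -[X in `]-oo, X]]oppr0 ge0_integration_by_substitutionNy.
  - by apply: eq_integral => x _; rewrite /= normal_pdf_even /q opprK.
  - exact: continuous_subspaceT.
  - by move=> x _; rewrite mulr_ge0 ?normal_pdf_ge0.
have l1 := L2_L1 lX.
have lp : L1 P (p \o X).
  apply: (L1_le _ _ (L1_norm l1)); first exact: measurableT_comp.
  by move=> w /=; rewrite ger0_norm// ge_max ler_norm/=.
have lq : L1 P (q \o X).
  apply: (L1_le _ _ (L1_norm l1)); first exact: measurableT_comp.
  by move=> w /=; rewrite ger0_norm// ge_max normr_ge0 -normrN ler_norm.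
have -> : Ex P X = Ex P (fun w => p (X w) - q (X w)).
  congr Ex; apply/funext => w; rewrite /p /q; case: (leP (X w) 0) => x0.
    by rewrite max_l ?oppr_ge0// sub0r opprK.
  by rewrite max_r ?subr0// oppr_le0 ltW.
by rewrite ExB// /Ex /Rintegral pq subrr.
Qed.

End gaussian.

(** * Brownian increments and the augmented filtration *)

Section sub_sigma_algebra.
Context d (T : measurableType d) {R : realType}.
Implicit Types (G : set (set T)) (X Y : T -> R).

(** Measurability of functions for a generated sub-sigma-algebra is measurability
    on the type that carries this sigma-algebra, where the closure properties of
    measurable functions are available. *)
Lemma measurable_wrtP G X :
  measurable_wrt <<s G >> X <->
  @measurable_fun _ _ (g_sigma_algebraType G) R setT X.
Proof.
split=> [GX _ B mB|mX _ [B mB <-]]; first by apply: GX; exists B.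
by apply: mX.
Qed.

Lemma measurable_wrtS G1 G2 X : G1 `<=` G2 ->
  measurable_wrt G1 X -> measurable_wrt G2 X.
Proof. by move=> G12 G1X; exact: subset_trans G12. Qed.

Lemma measurable_wrtD G X Y : measurable_wrt <<s G >> X ->
  measurable_wrt <<s G >> Y -> measurable_wrt <<s G >> (fun w => X w + Y w).
Proof.
move=> /measurable_wrtP mX /measurable_wrtP mY; apply/measurable_wrtP.
exact: measurable_funD.
Qed.

Lemma measurable_wrtM G X Y : measurable_wrt <<s G >> X ->
  measurable_wrt <<s G >> Y -> measurable_wrt <<s G >> (fun w => X w * Y w).
Proof.
move=> /measurable_wrtP mX /measurable_wrtP mY; apply/measurable_wrtP.
exact: measurable_funM.
Qed.

Lemma measurable_wrt_cst G c : measurable_wrt <<s G >> (fun=> c : R).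
Proof. by apply/measurable_wrtP; exact: measurable_cst. Qed.

Lemma measurable_wrt_comp G (f : R -> R) X : measurable_fun setT f ->
  measurable_wrt <<s G >> X -> measurable_wrt <<s G >> (f \o X).
Proof.
move=> mf /measurable_wrtP mX; apply/measurable_wrtP; exact: measurableT_comp.
Qed.

Lemma measurable_wrtB G X Y : measurable_wrt <<s G >> X ->
  measurable_wrt <<s G >> Y -> measurable_wrt <<s G >> (fun w => X w - Y w).
Proof.
move=> /measurable_wrtP mX /measurable_wrtP mY; apply/measurable_wrtP.
exact: measurable_funB.
Qed.

Lemma measurable_wrt_sum G (n : nat) (X : nat -> T -> R) :
  (forall i, (i < n)%N -> measurable_wrt <<s G >> (X i)) ->
  measurable_wrt <<s G >> (fun w => \sum_(i < n) X i w).
Proof.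
elim: n => [|n IH] mX.
  rewrite (_ : (fun w => _) = fun=> 0); first exact: measurable_wrt_cst.
  by apply/funext => w; rewrite big_ord0.
rewrite (_ : (fun w => _) = (fun w => \sum_(i < n) X i w + X n w)).
  by apply: measurable_wrtD; [apply: IH => i ni; apply: mX; exact: ltnW|exact: mX].
by apply/funext => w; rewrite big_ord_recr.
Qed.

End sub_sigma_algebra.

Section brownian_increments.
Context d (T : measurableType d) {R : realType} (P : probability T R).
Variable W : R -> {RV P >-> R}.
Local Notation F := (brownian_filtration W).
Implicit Types X Y : T -> R.

Lemma history_measurable t A : history W t A -> measurable A.
Proof.
apply: smallest_sub; first exact: sigma_algebra_measurable.
by move=> _ [u _ [B mB <-]]; exact: measurable_funPT.
Qed.

Lemma filtration_measurable t A : F t A -> measurable A.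
Proof.
apply: smallest_sub; first exact: sigma_algebra_measurable.
by move=> B [/history_measurable|[]].
Qed.

Lemma measurable_wrt_filtration t X : measurable_wrt (F t) X ->
  measurable_fun setT X.
Proof. by move=> FX _ B mB; apply: (@filtration_measurable t); apply: FX; exists B. Qed.

Lemma history_mono s t : s <= t -> history W s `<=` history W t.
Proof.
move=> st; apply: sub_sigma_algebra2.
move=> A [u + WA]; rewrite /= in_itv/= => /andP[u0 us].
exists u => //=.
by rewrite in_itv/= u0 (le_trans us).
Qed.

Lemma filtration_mono s t : s <= t -> F s `<=` F t.
Proof.
move=> st; apply: sub_sigma_algebra2.
by move=> A [hA|nA]; [left; exact: history_mono hA|right].
Qed.

Lemma brownian_adapted u t : 0 <= u -> u <= t -> measurable_wrt (F t) (W u).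
Proof.
move=> u0 ut A WA; apply: sub_sigma_algebra; left; apply: sub_sigma_algebra.
by exists u => //=; rewrite in_itv/= u0.
Qed.

(** Augmenting by null sets changes each event only up to a null set, so the
    independence of the increments extends to the augmented filtration. *)
Lemma filtration_almost_history t A : F t A ->
  exists2 A', history W t A' &
    exists N, [/\ measurable N, P N = 0%E, A `\` N `<=` A' & A' `\` N `<=` A].
Proof.
suff: F t `<=` [set A | exists2 A', history W t A' &
    exists N, [/\ measurable N, P N = 0%E, A `\` N `<=` A' & A' `\` N `<=` A]].
  exact.
have [h0 hC hU] : sigma_algebra setT (history W t).
  exact: smallest_sigma_algebra.
apply: smallest_sub.
  split.
  - exists set0 => //; exists set0; rewrite measure0; split => //.
  - move=> B [B' hB' [N [mN PN s1 s2]]]; exists (setT `\` B'); first exact: hC.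
    exists N; split => //.
    + move=> w [[_ nB] nN]; split => // B'w; apply: nB; exact: s2.
    + move=> w [[_ nB] nN]; split => // B'w; apply: nB; exact: s1.
  - move=> B hB.
    have /choice[B' hB'] : forall n, exists B', history W t B' /\ exists N,
        [/\ measurable N, P N = 0%E, B n `\` N `<=` B' & B' `\` N `<=` B n].
      by move=> n; have [B' h1 h2] := hB n; exists B'.
    have /choice[N hN] : forall n, exists N,
        [/\ measurable N, P N = 0%E, B n `\` N `<=` B' n & B' n `\` N `<=` B n].
      by move=> n; have [_] := hB' n.
    exists (\bigcup_n B' n); first by apply: hU => n; have [] := hB' n.
    exists (\bigcup_n N n); split.
    + by apply: bigcup_measurable => n _; have [] := hN n.
    + apply/eqP; rewrite eq_le measure_ge0 andbT.
      apply: (@le_trans _ _ (\sum_(n <oo) P (N n))%E).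
        apply: measure_sigma_subadditive => //.
        * by move=> n; have [] := hN n.
        * by apply: bigcup_measurable => n _; have [] := hN n.
      by rewrite eseries0// => n _ _; have [] := hN n.
    + move=> w [[n _ Bn] nN]; exists n => //; have [_ _ s1 _] := hN n.
      by apply: s1; split => // Nn; apply: nN; exists n.
    + move=> w [[n _ Bn] nN]; exists n => //; have [_ _ _ s1] := hN n.
      by apply: s1; split => // Nn; apply: nN; exists n.
move=> B [hB|[mB PB]].
  exists B => //; exists set0; rewrite measure0; split => //; exact: subDsetl.
exists set0 => //; exists B; split => //; last by move=> w [].
by move=> w [].
Qed.

Lemma almost_equal_measure (A B N : set T) :
  measurable A -> measurable B -> measurable N -> P N = 0%E ->
  A `\` N `<=` B -> B `\` N `<=` A -> P A = P B.
Proof.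
move=> mA mB mN PN AB BA.
have le C D : measurable C -> measurable D -> C `\` N `<=` D -> (P C <= P D)%E.
  move=> mC mD CD; rewrite -[leRHS]adde0 -PN.
  apply: le_trans (measureU2 _ mD mN).
  apply: le_measure; rewrite ?inE//; first exact: measurableU.
  by move=> w Cw; have [Nw|nN] := pselect (N w); [right|left; exact: CD].
by apply/eqP; rewrite eq_le !le.
Qed.

Lemma filtration_indep s t : brownian_motion W -> 0 <= s -> s < t ->
  forall A (B : set R), F s A -> measurable B ->
  P (A `&` (W t \- W s) @^-1` B) = (P A * P ((W t \- W s)%R @^-1` B))%E.
Proof.
move=> [_ _ _ indep] s0 st A B FA mB.
have [A' hA' [N [mN PN s1 s2]]] := filtration_almost_history FA.
have mA := filtration_measurable FA; have mA' := history_measurable hA'.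
have mWB : measurable ((W t \- W s) @^-1` B).
  rewrite -[X in measurable X]setTI.
  exact: (measurable_funB (measurable_funPT (W t)) (measurable_funPT (W s))).
rewrite (almost_equal_measure mA mA' mN PN s1 s2) -indep//.
apply: (almost_equal_measure _ _ mN PN).
- exact: measurableI.
- exact: measurableI.
- by move=> w [[Aw Bw] nN]; split => //; exact: s1.
- by move=> w [[Aw Bw] nN]; split => //; exact: s2.
Qed.

Hypothesis BW : brownian_motion W.

Lemma increment_moments s t : 0 <= s -> s <= t ->
  [/\ L2 P (fun w => W t w - W s w), Ex P (fun w => W t w - W s w) = 0 &
      Ex P (fun w => (W t w - W s w) ^+ 2) = t - s].
Proof.
move=> s0; rewrite le_eqVlt => /predU1P[<-|st].
  rewrite (_ : (fun w => W s w - W s w) = cst 0); last first.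
    by apply/funext => w; rewrite subrr.
  rewrite (_ : (fun w => (W s w - W s w) ^+ 2) = cst 0); last first.
    by apply/funext => w; rewrite subrr expr0n.
  by rewrite !Ex_cst subrr; split => //; exact: L2_cst.
have [_ _ law _] := BW.
have sts : Num.sqrt (t - s) != 0 by rewrite gt_eqF// sqrtr_gt0 subr_gt0.
rewrite -[X in [/\ _, _ & _ = X]](@sqr_sqrtr _ (t - s)) ?subr_ge0 ?ltW//.
apply: (normal_law_moments sts) => [|B mB]; last exact: law.
exact: measurable_funB.
Qed.

Lemma increment_indep_mul s t Y (f : R -> R) : 0 <= s -> s <= t ->
  measurable_wrt (F s) Y -> L1 P Y -> measurable_fun setT f ->
  L1 P (fun w => f (W t w - W s w)) ->
  L1 P (fun w => Y w * f (W t w - W s w)) /\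
  Ex P (fun w => Y w * f (W t w - W s w)) =
    Ex P Y * Ex P (fun w => f (W t w - W s w)).
Proof.
move=> s0; rewrite le_eqVlt => /predU1P[<- FY lY mf _|st FY lY mf lf].
  rewrite (_ : (fun w => f _) = cst (f 0)); last first.
    by apply/funext => w; rewrite subrr.
  rewrite (_ : (fun w => Y w * f _) = (fun w => f 0 * Y w)); last first.
    by apply/funext => w; rewrite subrr mulrC.
  by rewrite Ex_cst ExZ// mulrC; split => //; exact: L1Z.
apply: indep_mul => // A B mA mB.
have mfB : measurable (f @^-1` B) by rewrite -[X in measurable X]setTI; exact: mf.
apply: (filtration_indep BW s0 st _ mfB).
by apply: FY; exists A => //; rewrite setTI.
Qed.

(** The first of the two moment identities behind the isometry: a variable known
    at time [s] is orthogonal to the increment that follows. *)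
Lemma increment_mean0 s t Y : 0 <= s -> s <= t ->
  measurable_wrt (F s) Y -> L1 P Y ->
  L1 P (fun w => Y w * (W t w - W s w)) /\
  Ex P (fun w => Y w * (W t w - W s w)) = 0.
Proof.
move=> s0 st FY lY; have [l2 e1 _] := increment_moments s0 st.
have [l1 ->] := @increment_indep_mul _ _ _ idfun s0 st FY lY (@measurable_id _ _ _) (L2_L1 l2).
by rewrite e1 mulr0.
Qed.

Lemma increment_square s t Y : 0 <= s -> s <= t ->
  measurable_wrt (F s) Y -> L1 P Y ->
  L1 P (fun w => Y w * (W t w - W s w) ^+ 2) /\
  Ex P (fun w => Y w * (W t w - W s w) ^+ 2) = Ex P Y * (t - s).
Proof.
move=> s0 st FY lY; have [l2 _ e2] := increment_moments s0 st.
have [l1 ->] := @increment_indep_mul _ _ _ (fun x => x ^+ 2) s0 st FY lY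
  (@exprn_measurable _ _ 2) (L2_sqr l2).
by rewrite e2.
Qed.

End brownian_increments.

(** * Discrete stochastic integrals and their truncation *)

Section martingale_transform.
Context d (T : measurableType d) {R : realType} (P : probability T R).
Variable W : R -> {RV P >-> R}.
Local Notation F := (brownian_filtration W).
Hypothesis BW : brownian_motion W.
Variable u : nat -> R.
Hypothesis u_ge0 : 0 <= u 0%N.
Hypothesis u_le : forall i, u i <= u i.+1.
Implicit Types a b : nat -> T -> R.

Definition previsible a := forall i,
  measurable_wrt (F (u i)) (a i) /\ exists M, forall w, `|a i w| <= M.

Definition transform a n w := \sum_(i < n) a i w * (W (u i.+1) w - W (u i) w).

Definition budget a n w := \sum_(i < n) a i w ^+ 2 * (u i.+1 - u i).

(** The budget includes the step [i] itself.  Its size is known at time [u i], so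
    [truncate K a] is again previsible, and it never overspends. *)
Definition truncate K a i w := if budget a i.+1 w <= K then a i w else 0.

Lemma partition_mono i j : (i <= j)%N -> u i <= u j.
Proof. by apply: (homo_leq (r := fun x y => x <= y)) => // y x z; exact: le_trans. Qed.

Lemma partition_ge0 i : 0 <= u i.
Proof. exact: le_trans (partition_mono (leq0n i)). Qed.

Lemma increment_wrt i k : (i < k)%N ->
  measurable_wrt (F (u k)) (fun w => W (u i.+1) w - W (u i) w).
Proof.
move=> ik; apply: measurable_wrtB; apply: brownian_adapted => //; try exact: partition_ge0.
  exact: partition_mono.
by apply: partition_mono; exact: ltnW.
Qed.

Lemma previsible_wrt a i k : previsible a -> (i <= k)%N ->
  measurable_wrt (F (u k)) (a i).
Proof.
move=> pa ik; apply: measurable_wrtS (pa i).1.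
by apply: filtration_mono; exact: partition_mono.
Qed.

Lemma transform_wrt a n : previsible a ->
  measurable_wrt (F (u n)) (transform a n).
Proof.
move=> pa.
apply: (@measurable_wrt_sum _ _ _ _ n (fun i w => a i w * (W (u i.+1) w - W (u i) w))).
move=> i ni; apply: measurable_wrtM; last exact: increment_wrt.
by apply: previsible_wrt => //; exact: ltnW.
Qed.

Lemma transformS a n : transform a n.+1 =
  (fun w => transform a n w + a n w * (W (u n.+1) w - W (u n) w)).
Proof. by apply/funext => w; rewrite /transform big_ord_recr. Qed.

Lemma transform0 a : transform a 0 = cst 0.
Proof. by apply/funext => w; rewrite /transform big_ord0. Qed.

Lemma previsible_measurable a i : previsible a -> measurable_fun setT (a i).
Proof. by move=> pa; exact: measurable_wrt_filtration (pa i).1. Qed.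

Lemma previsible_L2 a i : previsible a -> L2 P (a i).
Proof.
move=> pa; have [M aM] := (pa i).2.
exact: L2_bounded (previsible_measurable i pa) aM.
Qed.

Lemma previsible_step_L2 a i : previsible a ->
  L2 P (fun w => a i w * (W (u i.+1) w - W (u i) w)).
Proof.
move=> pa; have [M aM] := (pa i).2.
apply: (L2_bounded_mul (previsible_measurable i pa) aM).
by have [] := increment_moments BW (partition_ge0 i) (u_le i).
Qed.

Lemma transform_L2 a n : previsible a -> L2 P (transform a n).
Proof.
move=> pa; elim: n => [|n IH]; first by rewrite transform0; exact: L2_cst.
by rewrite transformS; apply: L2D => //; exact: previsible_step_L2.
Qed.

Lemma transform_mean0 a n : previsible a -> Ex P (transform a n) = 0.
Proof.
move=> pa; elim: n => [|n IH]; first by rewrite transform0 Ex_cst.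
rewrite transformS ExD; [|exact/L2_L1/transform_L2|exact/L2_L1/previsible_step_L2].
rewrite IH add0r; apply: (increment_mean0 BW (partition_ge0 n) (u_le n) (pa n).1 _).2.
exact/L2_L1/previsible_L2.
Qed.

(** Ito isometry in bilinear form: mixed terms vanish since an increment is
    centred and independent of everything that precedes it. *)
Lemma transform_isometry a b n : previsible a -> previsible b ->
  Ex P (fun w => transform a n w * transform b n w) =
  \sum_(i < n) Ex P (fun w => a i w * b i w) * (u i.+1 - u i).
Proof.
move=> pa pb; elim: n => [|n IH].
  rewrite big_ord0 (_ : (fun w => _) = cst 0) ?Ex_cst//.
  by apply/funext => w; rewrite transform0 mul0r.
rewrite big_ord_recr/= -IH.
have un := partition_ge0 n; have un1 := u_le n.
have La := transform_L2 n pa; have Lb := transform_L2 n pb.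
have Fa := @transform_wrt a n pa; have Fb := @transform_wrt b n pb.
have l1 : L1 P (fun w => transform a n w * b n w) by apply: L2M (previsible_L2 _ _).
have l2 : L1 P (fun w => transform b n w * a n w) by apply: L2M (previsible_L2 _ _).
have l3 : L1 P (fun w => a n w * b n w) by apply: L2M; exact: previsible_L2.
have [c1 e1] := increment_mean0 BW un un1 (measurable_wrtM Fa (pb n).1) l1.
have [c2 e2] := increment_mean0 BW un un1 (measurable_wrtM Fb (pa n).1) l2.
have [c3 e3] := increment_square BW un un1 (measurable_wrtM (pa n).1 (pb n).1) l3.
rewrite -[LHS](_ : Ex P (fun w => (transform a n w * transform b n w +
    transform a n w * b n w * (W (u n.+1) w - W (u n) w)) +
    (transform b n w * a n w * (W (u n.+1) w - W (u n) w) +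
    a n w * b n w * (W (u n.+1) w - W (u n) w) ^+ 2)) = _); last first.
  by congr Ex; apply/funext => w; rewrite !transformS; ring.
have l0 := L2M La Lb.
rewrite ExD; [|exact: L1D|exact: L1D].
by rewrite ExD// ExD// e1 e2 e3; ring.
Qed.

Lemma budgetS a n w : budget a n.+1 w = budget a n w + a n w ^+ 2 * (u n.+1 - u n).
Proof. by rewrite /budget big_ord_recr. Qed.

Lemma budget_mono a i j w : (i <= j)%N -> budget a i w <= budget a j w.
Proof.
apply: (@homo_leq _ (budget a ^~ w) (fun x y => x <= y)) => // [y x z|k];
  first exact: le_trans.
by rewrite budgetS lerDl mulr_ge0 ?sqr_ge0 ?subr_ge0.
Qed.

Lemma budget_wrt a n : previsible a -> measurable_wrt (F (u n)) (budget a n.+1).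
Proof.
move=> pa.
apply: (@measurable_wrt_sum _ _ _ _ _ (fun i w => a i w ^+ 2 * (u i.+1 - u i))).
move=> i ni; apply: measurable_wrtM; last exact: measurable_wrt_cst.
by apply: (measurable_wrt_comp (exprn_measurable 2)); exact: previsible_wrt.
Qed.

Lemma truncate_previsible K a : previsible a -> previsible (truncate K a).
Proof.
move=> pa i; split; last first.
  have [M aM] := (pa i).2; exists M => w; rewrite /truncate.
  by case: ifP => // _; rewrite normr0 (le_trans _ (aM w)).
have := measurable_wrtM (measurable_wrt_comp
  (measurable_indic (measurable_itv `]-oo, K])) (budget_wrt pa)) (pa i).1.
congr measurable_wrt; apply/funext => w; rewrite /truncate /= indicE.
case: ifPn => bK; first by rewrite mem_set ?mul1r//= in_itv.
by rewrite memNset ?mul0r//= in_itv/=; exact/negP.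
Qed.

Lemma truncate_id K a n w : budget a n w <= K ->
  forall i, (i < n)%N -> truncate K a i w = a i w.
Proof.
by move=> bK i ni; rewrite /truncate (le_trans (budget_mono a w ni) bK).
Qed.

(** The budget is nondecreasing, so truncation keeps an initial segment of steps
    and drops all later ones. *)
Lemma truncate_stop K a n w : exists2 k, (k <= n)%N &
  forall i, (i < n)%N -> truncate K a i w = if (i < k)%N then a i w else 0.
Proof.
elim: n => [|n [k kn IH]]; first by exists 0%N.
have [bK|bK] := leP (budget a n.+1 w) K.
  by exists n.+1 => // i ni; rewrite ni; exact: truncate_id bK _ ni.
exists k; first exact: leq_trans kn _.
move=> i; rewrite ltnS leq_eqVlt => /predU1P[->|]; last exact: IH.
by rewrite ltnNge kn/= /truncate leNgt bK.
Qed.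

Lemma truncate_transform K a n w : exists2 k, (k <= n)%N &
  transform (truncate K a) n w = transform a k w.
Proof.
have [k kn h] := truncate_stop K a n w; exists k => //.
rewrite /transform (big_ord_widen n (fun i => a i w * (W (u i.+1) w - W (u i) w)) kn).
rewrite [RHS]big_mkcond/=; apply: eq_bigr => i _; rewrite h//.
by case: ifP => //; rewrite mul0r.
Qed.

Lemma truncate_budget K a n w : 0 <= K -> budget (truncate K a) n w <= K.
Proof.
move=> K0; have le_a m : budget (truncate K a) m w <= budget a m w.
  apply: ler_sum => i _; rewrite ler_wpM2r ?subr_ge0// /truncate.
  by case: ifP => // _; rewrite expr0n sqr_ge0.
elim: n => [|n IH]; first by rewrite /budget big_ord0.
have [bK|bK] := leP (budget a n.+1 w) K; first exact: le_trans bK.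
have tn : truncate K a n w = 0 by rewrite /truncate leNgt bK.
by rewrite budgetS tn expr0n mul0r addr0.
Qed.

End martingale_transform.

(** * Simple processes on a partition of a time interval *)

Section partition.
Context d (T : measurableType d) {R : realType} (P : probability T R).
Variable W : R -> {RV P >-> R}.
Local Notation F := (brownian_filtration W).
Variables (S : simple_process F) (s t : R).
Hypothesis st : s < t.
Let N := simple_size S.
Let tau := simple_time S.
Let c := simple_coef S.

Let clamp x := Num.max s (Num.min x t).

Let u i := if i is i'.+1 then if (i' <= N)%N then clamp (tau i') else t else s.

Let a i : T -> R := if i is i'.+1 then
  if (i' < N)%N && (tau i' < t) then c i' else cst 0 else cst 0.

Let clamp_le x y : x <= y -> clamp x <= clamp y.
Proof.
by move=> xy; rewrite ge_max !le_max lexx/= le_min !ge_min xy lexx !orbT.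
Qed.

Let clamp_gt x : s < clamp x -> clamp x <= x.
Proof.
by rewrite lt_max ltxx => /= h; rewrite /clamp max_r ?(ltW h)// ge_min lexx.
Qed.

Let clamp_lt x : clamp x < t -> x <= clamp x.
Proof.
rewrite gt_max => /andP[_]; rewrite gt_min ltxx orbF => h.
by rewrite /clamp (min_l (ltW h)) le_max lexx orbT.
Qed.

Let clamp_lub x : clamp x <= t.
Proof. by rewrite ge_max ltW//= ge_min lexx orbT. Qed.

Let clamp_glb x : s <= clamp x.
Proof. by rewrite le_max lexx. Qed.

Let tau_mono i j : (i <= j)%N -> tau i <= tau j.
Proof.
apply: (@homo_leq _ tau (fun x y => x <= y)) => // [y x z|k].
  exact: le_trans.
exact: simple_time_le.
Qed.

Let u_le i : u i <= u i.+1.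
Proof.
case: i => [|i] /=; first exact: clamp_glb.
case: (ltnP i N) => iN; first by rewrite ltnW//; exact/clamp_le/tau_mono.
by case: ifP.
Qed.

Let cell k : u k < u k.+1 ->
  (exists2 j, (j < N)%N & [/\ tau j <= u k, u k.+1 <= tau j.+1 & a k = c j]) \/
  ((u k.+1 <= tau 0%N \/ tau N <= u k) /\ a k = cst 0).
Proof.
case: k => [|j]; first by move=> /clamp_gt h; right; split; [left|].
rewrite /u /a; case: (ltnP j N) => jN.
  rewrite (ltnW jN) => h; left; exists j => //.
  have ht : clamp (tau j) < t by exact: lt_le_trans h (clamp_lub _).
  have hs : s < clamp (tau j.+1) by exact: le_lt_trans (clamp_glb _) h.
  by rewrite /= (le_lt_trans (clamp_lt ht) ht); split; [exact: clamp_lt|exact: clamp_gt|].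
case: ifP => jN'; last by rewrite ltxx.
have -> : j = N by apply/eqP; rewrite eqn_leq jN jN'.
by move=> h; right; split => //; right; exact: clamp_lt.
Qed.

Let a_previsible : previsible W u a.
Proof.
case=> [|i]; rewrite /a.
  by split; [exact: measurable_wrt_cst|exists 0 => w; rewrite normr0].
case: ifPn => [/andP[iN it]|_]; last first.
  by split; [exact: measurable_wrt_cst|exists 0 => w; rewrite normr0].
split; last exact: simple_coef_bounded.
apply: (@measurable_wrtS _ _ _ (F (tau i))); last exact: simple_coef_measurable.
apply: filtration_mono; rewrite /u (ltnW iN).
by rewrite /clamp (min_l (ltW it)) le_max lexx orbT.
Qed.

Let value_cell k r w : u k < r -> r <= u k.+1 -> simple_value S r w = a k w.
Proof.
move=> kr rk; rewrite /simple_value.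
have term0 i : r <= tau i \/ tau i.+1 < r ->
    c i w * \1_(`]tau i, tau i.+1]%classic) r = 0.
  move=> h; rewrite indicE memNset ?mulr0//= in_itv/= => /andP[h1 h2].
  by case: h => h; lra.
case: (cell (lt_le_trans kr rk)) => [[j jN [h1 h2 ->]]|[h ->]].
  rewrite (bigD1 (Ordinal jN))//= big1 => [|i /eqP ij].
    rewrite addr0 indicE mem_set ?mulr1//= in_itv/=; apply/andP; split.
      exact: le_lt_trans kr.
    exact: le_trans h2.
  apply: term0; case: (ltngtP i j) => [iltj|jlti|ij'].
  - right; apply: le_lt_trans kr; apply: le_trans h1; exact: tau_mono.
  - left; apply: (le_trans rk); apply: (le_trans h2); exact: tau_mono.
  - by exfalso; apply: ij; exact: val_inj.
rewrite big1// => i _; apply: term0; case: h => h.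
  by left; apply: (le_trans rk); apply: (le_trans h); exact: tau_mono.
by right; apply: le_lt_trans kr; apply: le_trans h; exact: tau_mono.
Qed.

Let integral_cell k w : simple_integral W S (u k.+1) w - simple_integral W S (u k) w
  = a k w * (W (u k.+1) w - W (u k) w).
Proof.
have := u_le k; rewrite le_eqVlt => /predU1P[->|uk]; first by rewrite !subrr mulr0.
rewrite /simple_integral -sumrB.
have term0 i : u k.+1 <= tau i \/ tau i.+1 <= u k ->
    c i w * (W (Num.min (tau i.+1) (u k.+1)) w - W (Num.min (tau i) (u k.+1)) w) -
    c i w * (W (Num.min (tau i.+1) (u k)) w - W (Num.min (tau i) (u k)) w) = 0.
  have ti := tau_mono (leqnSn i).
  case=> h.
    by rewrite !min_r ?subrr//; lra.
  by rewrite !min_l ?subrr//; lra.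
case: (cell uk) => [[j jN [h1 h2 ->]]|[h ->]].
  rewrite (bigD1 (Ordinal jN))//= big1 => [|i /eqP ij].
    rewrite addr0 -/tau -/c (min_r h2) (min_l h1) (@min_l _ _ (tau j) (u k.+1)); last by lra.
    by rewrite (@min_r _ _ _ (u k)); [ring|lra].
  apply: term0; case: (ltngtP i j) => [iltj|jlti|ij'].
  - by right; apply: le_trans h1; exact: tau_mono.
  - by left; apply: (le_trans h2); exact: tau_mono.
  - by exfalso; apply: ij; exact: val_inj.
rewrite mul0r big1// => i _; apply: term0; case: h => h.
  by left; apply: (le_trans h); exact: tau_mono.
by right; apply: le_trans h; exact: tau_mono.
Qed.

(** The times of [S] clamped to [[s, t]], with [s] put in front and [t] at the end,
    cut [[s, t]] into steps on each of which [S] is constant.  Starting exactly at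
    [s] and ending at [t] makes the increments of [W] add up to [W t - W s]. *)
Lemma simple_process_partition : exists n (v : nat -> R) (b : nat -> T -> R),
  [/\ v 0%N = s, v n = t, forall i, v i <= v i.+1, previsible W v b &
   forall i w,
     (forall r, v i < r -> r <= v i.+1 -> simple_value S r w = b i w) /\
     simple_integral W S (v i.+1) w - simple_integral W S (v i) w =
       b i w * (W (v i.+1) w - W (v i) w)].
Proof.
exists N.+2, u, a; split => //; first by rewrite /u ltnn.
by move=> i w; split => [r|]; [exact: value_cell|exact: integral_cell].
Qed.

End partition.

(** * Increments of simple integrals with bounded energy *)

Section controlled_increment.
Context d (T : measurableType d) {R : realType} (P : probability T R).
Variable W : R -> {RV P >-> R}.
Local Notation F := (brownian_filtration W).
Local Notation mu := (@lebesgue_measure R).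
Hypothesis BW : brownian_motion W.

(** What is needed of an energy-truncated increment, without reference to the
    partition it comes from: [X] replaces the increment of the simple integral
    over [[s, t]], [V] is the integral in time of the truncated simple process,
    that is the covariation of [X] with [W], and [Q] is the energy before
    truncation. *)
Record controlled_increment (S : simple_process F) (s t K : R)
    (X V Q : T -> R) : Prop := ControlledIncrement {
  ci_L2 : L2 P X;
  ci_sqr : Ex P (fun w => X w ^+ 2) <= K;
  ci_drift_measurable : measurable_fun setT V;
  ci_drift_bounded : forall w, `|V w| <= (t - s) + K;
  ci_energy_measurable : measurable_fun setT Q;
  ci_energy : forall w,
    (\int[mu]_(r in `]s, t]) (simple_value S r w ^+ 2)%:E = (Q w)%:E)%E;
  ci_mean0 : forall (g : T -> R) (M : R), measurable_wrt (F s) g ->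
    (forall w, `|g w| <= M) -> Ex P (fun w => g w * X w) = 0;
  ci_covariation : forall (g : T -> R) (M : R), measurable_wrt (F s) g ->
    (forall w, `|g w| <= M) ->
    Ex P (fun w => g w * X w * (W t w - W s w)) = Ex P (fun w => g w * V w);
  ci_stopped : forall w, exists r, [/\ s <= r, r <= t &
    X w = simple_integral W S r w - simple_integral W S s w];
  ci_unstopped : forall w, Q w <= K ->
    X w = simple_integral W S t w - simple_integral W S s w;
  ci_drift_ge : forall w (h e k : R), Q w <= K -> 0 < k ->
    (\int[mu]_(r in `]s, t]) ((simple_value S r w - h) ^+ 2)%:E <= e%:E)%E ->
    (t - s) * (h - k) - e / k <= V w }.

Lemma measurable_simple_value (S : simple_process F) w :
  measurable_fun setT (fun r => simple_value S r w).
Proof.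
rewrite /simple_value; apply: measurable_sum => i.
by apply: measurable_funM => //; exact: measurable_indic.
Qed.

(** [X] is the discrete integral of the truncated coefficients of [S].  Mean and
    covariation are those of discrete integrals, with [g] absorbed into the
    coefficients; the covariation pairs these with the constant coefficient 1. *)
Lemma exists_controlled_increment (S : simple_process F) (s t K : R) :
  0 <= s -> s < t -> 0 <= K ->
  exists X V Q, controlled_increment S s t K X V Q.
Proof.
move=> s0 st K0.
have [n [u [a [us ut u_le pa Sa]]]] := simple_process_partition S st.
have u0 : 0 <= u 0%N by rewrite us.
pose b := truncate u K a.
have pb : previsible W u b := truncate_previsible u_le K pa.
pose V w := \sum_(i < n) b i w * (u i.+1 - u i).
have du i : 0 <= u i.+1 - u i by rewrite subr_ge0.
have sum_du : \sum_(i < n) (u i.+1 - u i) = t - s.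
  rewrite -ut -us -(big_mkord predT (fun i => u i.+1 - u i)).
  exact: telescope_sumr.
have transformE k w : transform W u a k w =
    simple_integral W S (u k) w - simple_integral W S s w.
  elim: k => [|k IH]; first by rewrite transform0 us subrr.
  by rewrite transformS IH -(Sa k w).2; ring.
have energy h w : (\int[mu]_(r in `]s, t]) ((simple_value S r w - h) ^+ 2)%:E =
    (\sum_(i < n) (a i w - h) ^+ 2 * (u i.+1 - u i))%:E)%E.
  rewrite -us -ut; move: (n) => m.
  elim: m => [|m IH].
    by rewrite big_ord0 set_itv_ge ?integral_set0// bnd_simp ltxx.
  have mS : measurable_fun setT (fun r => ((simple_value S r w - h) ^+ 2)%:E).
    apply/measurable_EFinP; apply: measurable_funX; apply: measurable_funB => //.
    exact: measurable_simple_value.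
  have um := partition_mono u_le (leq0n m).
  rewrite (@itv_bndbnd_setU _ _ _ (BRight (u m))) ?bnd_simp// ge0_integral_setU//=; first last.
  - apply/disj_setPS => r [] /=; rewrite !in_itv/= => /andP[_ h1] /andP[h2 _]; lra.
  - by move=> r _; rewrite lee_fin sqr_ge0.
  - exact: measurable_funTS.
  rewrite IH big_ord_recr/= EFinD; congr (_ + _)%E.
  rewrite (eq_integral (cst ((a m w - h) ^+ 2)%:E)); last first.
    move=> r; rewrite inE/= in_itv/= => /andP[h1 h2].
    by rewrite (Sa m w).1.
  rewrite integral_cst//= lebesgue_measure_itv/= lte_fin.
  have := u_le m; rewrite le_eqVlt => /predU1P[->|->].
    by rewrite ltxx mule0 subrr mulr0.
  by [].
have cst1 : previsible W u (fun _ => cst 1).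
  move=> i; split; first exact: measurable_wrt_cst.
  by exists 1 => w; rewrite normr1.
have WE w : W t w - W s w = transform W u (fun _ => cst 1) n w.
  rewrite /transform; under eq_bigr do rewrite mul1r.
  rewrite -(big_mkord predT (fun i => W (u i.+1) w - W (u i) w)).
  by rewrite (telescope_sumr (fun i => W (u i) w))// us ut.
have scale g M : measurable_wrt (F s) g -> (forall w, `|g w| <= M) ->
    previsible W u (fun i w => g w * b i w).
  move=> Fg gM i; split.
    apply: measurable_wrtM (pb i).1; apply: measurable_wrtS Fg.
    by rewrite -us; apply: filtration_mono; exact: partition_mono.
  have [B bB] := (pb i).2; exists (M * B) => w.
  by rewrite normrM ler_pM.
have scaleE g w : g w * transform W u b n w =
    transform W u (fun i w => g w * b i w) n w.
  by rewrite /transform mulr_sumr; apply: eq_bigr => i _; rewrite mulrA.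
exists (transform W u b n), V, (budget u a n); split.
- exact: transform_L2.
- under [X in Ex P X]eq_fun do rewrite expr2.
  rewrite (transform_isometry BW u0 u_le n pb pb).
  have lb i : L1 P (fun w => b i w * b i w * (u i.+1 - u i)).
    under [X in L1 P X]eq_fun do rewrite mulrC.
    by apply: L1Z; apply: L2M; exact: previsible_L2.
  rewrite (eq_bigr (fun i : 'I_n => Ex P (fun w => b i w * b i w * (u i.+1 - u i)))); last first.
    move=> i _; rewrite mulrC -ExZ; last by apply: L2M; exact: previsible_L2.
    by congr Ex; apply/funext => w; rewrite mulrC.
  rewrite -(Ex_sum (X := fun i w => b i w * b i w * (u i.+1 - u i)))//.
  rewrite -[leRHS](Ex_cst P); apply: Ex_le.
  - by apply: (@L1_sum _ _ _ _ n (fun i w => b i w * b i w * (u i.+1 - u i))).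
  - exact: L1_cst.
  move=> w /=; apply: le_trans (truncate_budget u_le a n w K0).
  by rewrite /budget le_eqVlt; apply/orP; left; apply/eqP; apply: eq_bigr => i _; rewrite expr2.
- apply: measurable_sum => i; apply: measurable_funM => //.
  exact: previsible_measurable pb.
- move=> w; apply: (le_trans (ler_norm_sum _ _ _)).
  rewrite -sum_du; apply: (le_trans _ (lerD (lexx _) (truncate_budget u_le a n w K0))).
  rewrite -big_split/=; apply: ler_sum => i _.
  rewrite normrM (ger0_norm (du i)); have := du i.
  set D := u i.+1 - u i => D0.
  have -> : D + b i w ^+ 2 * D = (1 + b i w ^+ 2) * D by ring.
  rewrite ler_wpM2r// -[b i w ^+ 2]real_normK ?num_real//.
  by have := sqr_ge0 (`|b i w| - 1); have := normr_ge0 (b i w); nra.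
- apply: measurable_sum => i; apply: measurable_funM => //.
  by apply: measurable_funX; exact: previsible_measurable pa.
- move=> w; have := energy 0 w.
  under eq_integral do rewrite subr0.
  by move=> ->; congr EFin; apply: eq_bigr => i _; rewrite subr0.
- move=> g M Fg gM; under [X in Ex P X]eq_fun do rewrite scaleE.
  exact: (transform_mean0 BW u0 u_le n (scale g M Fg gM)).
- move=> g M Fg gM; have pgb := scale g M Fg gM.
  under [X in Ex P X]eq_fun do rewrite scaleE WE.
  rewrite (transform_isometry BW u0 u_le n pgb cst1).
  rewrite (eq_bigr (fun i : 'I_n => Ex P (fun w => g w * b i w * (u i.+1 - u i)))); last first.
    move=> i _; under [X in Ex P X]eq_fun do rewrite mulr1.
    rewrite mulrC -ExZ; last first.
      exact: (L2_L1 (previsible_L2 i pgb)).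
    by congr Ex; apply/funext => w; rewrite mulrC.
  rewrite -(Ex_sum (X := fun i w => g w * b i w * (u i.+1 - u i))) => [|i _].
    by congr Ex; apply/funext => w; rewrite mulr_sumr; apply: eq_bigr => i _; rewrite mulrA.
  under [X in L1 P X]eq_fun do rewrite mulrC.
  by apply: L1Z; exact/L2_L1/(previsible_L2 i pgb).
- move=> w; have [k kn ->] := truncate_transform W u_le K a n w.
  exists (u k); split; last by rewrite transformE.
  - by rewrite -us; exact: partition_mono.
  - by rewrite -ut; exact: partition_mono.
- move=> w QK; rewrite -{1}ut -transformE; apply: eq_bigr => i _.
  by rewrite /b (truncate_id u_le QK).
- move=> w h e k QK k0; rewrite energy lee_fin => he.
  have -> : V w = \sum_(i < n) a i w * (u i.+1 - u i).
    by apply: eq_bigr => i _; rewrite /b (truncate_id u_le QK).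
  rewrite -sum_du mulr_suml lerBlDr.
  apply: (@le_trans _ _ (\sum_(i < n) a i w * (u i.+1 - u i) +
    (\sum_(i < n) (a i w - h) ^+ 2 * (u i.+1 - u i)) / k)); last first.
    by rewrite lerD2l ler_pM2r// invr_gt0.
  rewrite mulr_suml -big_split/=; apply: ler_sum => i _.
  rewrite mulrAC -mulrDl mulrC ler_wpM2r//.
  rewrite -subr_ge0.
  have -> : a i w + (a i w - h) ^+ 2 / k - (h - k) =
    ((a i w - h + k / 2) ^+ 2 + 3 / 4 * k ^+ 2) / k by field; lra.
  by rewrite divr_ge0 ?(ltW k0)// addr_ge0 ?sqr_ge0// mulr_ge0// sqr_ge0.
Qed.

End controlled_increment.

(** * Events of small probability *)

Section small_events.
Context d (T : measurableType d) {R : realType} (P : probability T R).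

(** The events decrease to a null set. *)
Lemma probability_tail_small (f : T -> \bar R) (e : R) : measurable_fun setT f ->
  {ae P, forall w, (f w < +oo)%E} -> 0 < e ->
  exists2 K : R, 0 <= K & (P [set w | (K%:E < f w)%E] <= e%:E)%E.
Proof.
move=> mf foo e0; pose A n := [set w | (n%:R%:E < f w)%E].
have mA n : measurable (A n).
  by rewrite -[X in measurable X]setTI; exact: emeasurable_fun_o_infty.
have mcapA : measurable (\bigcap_n A n) by exact: bigcapT_measurable.
have : P \o A @ \oo --> P (\bigcap_n A n).
  apply: nonincreasing_cvg_mu => //.
  - by rewrite -ge0_fin_numE// fin_num_measure.
  - move=> m n mn; apply/subsetPset => w.
    by rewrite /A /= => h; apply: (le_lt_trans _ h); rewrite lee_fin ler_nat.
have -> : P (\bigcap_n A n) = 0%E.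
  have [N [mN PN sN]] := foo; apply/eqP; rewrite eq_le measure_ge0 andbT -PN.
  apply: le_measure; rewrite ?inE//; apply: subset_trans sN => w Aw /=.
  apply/negP; rewrite -leNgt leye_eq; apply/eqP.
  have {}Aw n : (n%:R%:E < f w)%E := Aw n I.
  move: Aw; case: (f w) => [r| |] //= h.
    have := h (Num.truncn r).+1; rewrite lte_fin => /ltW.
    by rewrite leNgt truncnS_gt.
  by have := h 0%N.
move=> /fine_cvgP[_] /cvgrPdist_le /(_ e e0) [n _ /(_ n (leqnn n))] /= h.
exists n%:R => //; rewrite -[leLHS](fineK (fin_num_measure P _ (mA n))) lee_fin.
by move: h; rewrite sub0r normrN => /(le_trans (ler_norm _)).
Qed.

Lemma Ex_small_on_small_event (X : T -> R) (e : R) : L1 P X -> 0 < e ->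
  exists2 r : R, 0 < r & forall D, measurable D -> (P D < r%:E)%E ->
    Ex P (fun w => `|X w| * \1_D w) <= e.
Proof.
move=> lX e0; have [r [r0 h]] := integral_normr_continuous lX e0.
exists r => // D mD PD; apply/ltW; apply: le_lt_trans (h D mD PD).
rewrite [leRHS]Rintegral_mkcond /Ex le_eqVlt; apply/orP; left; apply/eqP.
apply: eq_Rintegral => w _; rewrite patchE indicE; case: ifP => _ /=.
  by rewrite mulr1.
by rewrite mulr0.
Qed.

(** Only countably many times need to be tested, because the paths are
    continuous. *)
Lemma measurable_running_sup (X : R -> T -> R) (t e : R) : 0 < t ->
  (forall r : R, 0 <= r -> measurable_fun setT (X r)) -> continuous_paths X ->
  measurable [set w | exists2 r, r \in `[0, t] & e < `|X r w|].
Proof.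
move=> t0 mX cX.
rewrite [X in measurable X](_ : _ = \bigcup_(q : rat)
  [set w | ratr q \in `[0, t] /\ e < `|X (ratr q) w|]).
  apply: bigcupT_measurable_rat => q.
  have [qt|qt] := boolP (ratr q \in `[0, t]); last first.
    by rewrite (_ : mkset _ = set0)//; apply/seteqP; split => w //= -[].
  have q0 : 0 <= ratr q :> R by move: qt; rewrite in_itv/= => /andP[].
  rewrite (_ : mkset _ = [set w | e < `|X (ratr q) w|]); last first.
    by apply/seteqP; split => w //= -[].
  rewrite -[X in measurable X]setTI.
  have mE : measurable_fun setT (fun w => (`|X (ratr q) w|)%:E).
    by apply/measurable_EFinP; apply: measurableT_comp => //; exact: mX.
  exact: (emeasurable_fun_o_infty measurableT mE e%:E).
apply/seteqP; split => w /=; last by case=> q _ /= [qt eX]; exists (ratr q).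
case=> r; rewrite in_itv/= => /andP[r0 rt] eX.
have /subspace_continuousP/(_ r) := cX w.
rewrite /= in_itv/= r0 => /(_ isT) cXr.
have ed : 0 < `|X r w| - e by rewrite subr_gt0.
move/cvgrPdist_lt : cXr => /(_ _ ed) [dl /= dl0 hd].
have : Num.max 0 (r - dl) < Num.min t (r + dl).
  by rewrite lt_min !gt_max t0/=; apply/and3P; split; lra.
move=> /rat_in_itvoo[q]; rewrite in_itv/= gt_max lt_min => /andP[/andP[q0 rq] /andP[qt qr]].
exists q => //=; split; first by rewrite in_itv/= !ltW.
have /= := hd (ratr q); rewrite in_itv/= andbT => /(_ _ (ltW q0)) => h.
have : `|r - ratr q| < dl by rewrite ltr_norml; apply/andP; split; lra.
move=> /h; have := ler_normD (X r w - X (ratr q) w) (X (ratr q) w).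
rewrite subrK; lra.
Qed.

End small_events.

(** * Approximation of an Ito integral by one simple process *)

Section ito_approximation.
Context d (T : measurableType d) {R : realType} (P : probability T R).
Variable W : R -> {RV P >-> R}.
Local Notation F := (brownian_filtration W).
Local Notation mu := (@lebesgue_measure R).
Hypothesis BW : brownian_motion W.

Lemma simple_times_ge0 (S : simple_process F) i : 0 <= simple_time S i.
Proof.
elim: i => [|i IH]; first exact: simple_time_ge0.
exact: le_trans IH (simple_time_le S i).
Qed.

Lemma measurable_simple_coef (S : simple_process F) i :
  measurable_fun setT (simple_coef S i).
Proof.
apply: (@measurable_wrt_filtration _ _ _ _ W (simple_time S i)).
exact: simple_coef_measurable.
Qed.

Lemma simple_integral_measurable (S : simple_process F) r :
  measurable_fun setT (simple_integral W S r).
Proof.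
apply: measurable_sum => i; apply: measurable_funM.
  exact: measurable_simple_coef.
exact: measurable_funB.
Qed.

Lemma simple_integral_continuous (S : simple_process F) :
  continuous_paths (simple_integral W S).
Proof.
move=> w; apply/subspace_continuousP => x; rewrite /= in_itv/= andbT => x0.
have stopW c : 0 <= c -> (fun r => W (Num.min c r) w) @ within `[0, +oo[ (nbhs x)
    --> W (Num.min c x) w.
  move=> c0; have [_ cW _ _] := BW.
  have /subspace_continuousP/(_ (Num.min c x)) := cW w.
  rewrite /= in_itv/= andbT le_min c0 x0 => /(_ isT) cWx.
  apply/cvgrPdist_lt => e e0.
  move/cvgrPdist_lt : cWx => /(_ _ e0) [dl /= dl0 hd].
  exists dl => //= r xr; rewrite in_itv/= andbT => r0.
  apply: hd; last by rewrite /= in_itv/= andbT le_min c0 r0.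
  rewrite /=; apply: le_lt_trans xr.
  case: (leP c x) => h1; case: (leP c r) => h2; rewrite ?subrr ?normr0//.
  - by rewrite !ger0_norm; lra.
  - by rewrite !ler0_norm; lra.
suff sums m : (fun r => \sum_(i < m) simple_coef S i w *
      (W (Num.min (simple_time S i.+1) r) w - W (Num.min (simple_time S i) r) w))
    @ within `[0, +oo[ (nbhs x) --> \sum_(i < m) simple_coef S i w *
      (W (Num.min (simple_time S i.+1) x) w - W (Num.min (simple_time S i) x) w).
  exact: sums.
elim: m => [|m IH].
  by rewrite big_ord0; under eq_fun do rewrite big_ord0; exact: cvg_cst.
rewrite big_ord_recr/=; under eq_fun do rewrite big_ord_recr/=.
apply: cvgD => //; apply: cvgM; first exact: cvg_cst.
by apply: cvgB; apply: stopW; exact: simple_times_ge0.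
Qed.

Lemma simple_value_joint_measurable (S : simple_process F) :
  measurable_fun [set: measurableTypeR R * T] (fun p => simple_value S p.1 p.2).
Proof.
apply: measurable_sum => i; apply: measurable_funM.
  by apply: measurableT_comp => //; exact: measurable_simple_coef.
by apply: measurableT_comp => //; exact: measurable_indic.
Qed.

(** Tonelli, after extending the integrand by 0 outside [[0, t]]. *)
Lemma square_integral_measurable (f : R -> T -> R) t :
  measurable_fun (`[0, +oo[ `*` setT : set (measurableTypeR R * T))
        (fun p => f p.1 p.2) ->
  measurable_fun setT
    (fun w => (\int[mu]_(r in `[0%R, t]) (f r w ^+ 2)%:E)%E).
Proof.
move=> mf.
pose D : set (measurableTypeR R * T) := `[0, t] `*` setT.
have mD : measurable D by apply: measurableX => //; exact: measurable_itv.
have mfD : measurable_fun D (fun p => (f p.1 p.2 ^+ 2)%:E).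
  apply/measurable_EFinP; apply: measurable_funX.
  apply: measurable_funS mf.
    by apply: measurableX => //; exact: measurable_itv.
  move=> [r w] [/=]; rewrite !in_itv/= => /andP[-> _] _; split => //.
have mg := (measurable_restrictT _ mD).1 mfD.
have g0 p : (0 <= ((fun p => (f p.1 p.2 ^+ 2)%:E) \_ D) p)%E.
  by rewrite patchE; case: ifP => // _; rewrite lee_fin sqr_ge0.
have := measurable_fun_fubini_tonelli_G (m1 := mu) _ mg g0.
apply: eq_measurable_fun => w _; rewrite /fubini_G [RHS]integral_mkcond.
apply: eq_integral => r _; rewrite !patchE.
rewrite (_ : ((r, w) \in D) = (r \in `[0, t]%classic))//.
by apply/idP/idP; rewrite !inE => //= -[].
Qed.

Lemma joint_section_measurable (f : R -> T -> R) (t : R) w :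
  measurable_fun (`[0, +oo[ `*` setT : set (measurableTypeR R * T))
        (fun p => f p.1 p.2) ->
  measurable_fun (`[0, t]%classic : set (measurableTypeR R)) (fun r => f r w).
Proof.
move=> mf mI B mB.
have mD : measurable (`[0, +oo[ `*` setT : set (measurableTypeR R * T)).
  by apply: measurableX => //; exact: measurable_itv.
have := measurableI _ _ mI (pair2_measurable w measurableT (mf mD B mB)).
congr measurable; apply/seteqP; split => r /=; rewrite !in_itv/= andbT.
  by move=> [? [_ [_ ?]]].
by move=> [/andP[r0 rt] ?]; split; [exact/andP|].
Qed.

(** The events on which the approximation fails are measurable, so that the
    convergence in probability really bounds them, and one index serves for both. *)
Lemma ito_approximation (H I : R -> T -> R) (t e1 e2 e : R) :
  ito_integral F W H I -> (forall r : R, 0 <= r -> measurable_fun setT (I r)) ->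
  0 < t -> 0 < e1 -> 0 < e2 -> 0 < e ->
  exists (S : simple_process F) (D A : set T),
    [/\ measurable D, measurable A, (P D < e%:E)%E, (P A < e%:E)%E &
     (forall w, ~ D w -> forall r : R, 0 <= r -> r <= t ->
        `|simple_integral W S r w - I r w| <= e1) /\
     (forall w, ~ A w -> (\int[mu]_(r in `[0%R, t])
        ((simple_value S r w - H r w) ^+ 2)%:E <= e2%:E)%E)].
Proof.
move=> [aH mH _ cI approx] mI t0 e10 e20 e0.
have [S hS] := approx t (ltW t0).
have lt0 (u : nat -> \bar R) : u @ \oo --> 0%E -> \forall n \near \oo, (u n < e%:E)%E.
  move=> /fine_cvgP[ufin /cvgrPdist_lt/(_ _ e0)].
  apply: filterS2 ufin => n un; rewrite /= sub0r normrN => h.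
  by rewrite -(fineK un) lte_fin (le_lt_trans (ler_norm _)).
have hA := lt0 _ (hS e2 e20).1; have hD := lt0 _ (hS e1 e10).2.
have [n _ /(_ n (leqnn n)) [An Dn]] := filterI hA hD.
exists (S n), [set w | exists2 s : R, s \in `[0, t] &
    e1 < `|simple_integral W (S n) s w - I s w|],
  [set w | (e2%:E < \int[mu]_(s in `[0%R, t])
                ((simple_value (S n) s w - H s w) ^+ 2)%:E)%E].
split => //.
- apply: (measurable_running_sup (X := fun r w => simple_integral W (S n) r w - I r w)) => //.
    move=> r r0; apply: measurable_funB; last exact: mI.
    exact: simple_integral_measurable.
  move=> w; have := @simple_integral_continuous (S n) w; have := cI w.
  move=> /subspace_continuousP c1 /subspace_continuousP c2.
  apply/subspace_continuousP => x x0.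
  by apply: cvgB; [exact: c2|exact: c1].
- rewrite -[X in measurable X]setTI; apply: emeasurable_fun_o_infty => //.
  apply: (square_integral_measurable (f := fun r w => simple_value (S n) r w - H r w)).
  apply: measurable_funB => //; apply: measurable_funTS.
  exact: simple_value_joint_measurable.
- split => w /= h; last by rewrite leNgt; apply/negP.
  move=> r r0 rt; rewrite leNgt; apply/negP => hr; apply: h; exists r => //.
  by rewrite in_itv/= r0.
Qed.

End ito_approximation.

(** * Bounded Ito integrals are martingales *)

Section bounded_ito_integrals.
Context d (T : measurableType d) {R : realType} (P : probability T R).
Variable W : R -> {RV P >-> R}.
Local Notation F := (brownian_filtration W).
Local Notation mu := (@lebesgue_measure R).
Hypothesis BW : brownian_motion W.

(** The form in which all the error terms below are collected. *)
Lemma le0_of_linear (x c : R) : (forall e : R, 0 < e -> x <= c * e) -> x <= 0.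
Proof.
move=> h; rewrite leNgt; apply/negP => x0.
have c1 : 0 < `|c| + 1 by rewrite ltr_wpDl.
have e0 : 0 < x / (2 * (`|c| + 1)) by rewrite divr_gt0// mulr_gt0.
have xE : (`|c| + 1) * (x / (2 * (`|c| + 1))) = x / 2 by field; rewrite gt_eqF.
have := h _ e0; have := ler_wpM2r (ltW e0) (ler_norm c); lra.
Qed.

Lemma fine_probability_le (A : set T) (e : R) : measurable A -> (P A < e%:E)%E ->
  fine (P A) <= e.
Proof.
by move=> mA PA; rewrite -lee_fin fineK ?fin_num_measure// ltW.
Qed.

Lemma square_integral_le (f : R -> R) (s t : R) :
  0 <= s -> measurable_fun (`[0, t]%classic : set (measurableTypeR R)) f ->
  (\int[mu]_(r in `]s, t]) ((f r) ^+ 2)%:E <=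
   \int[mu]_(r in `[0%R, t]) ((f r) ^+ 2)%:E)%E.
Proof.
move=> s0 mf; apply: ge0_subset_integral => //=.
- by apply/measurable_EFinP; exact: measurable_funX.
- by move=> r _; rewrite lee_fin sqr_ge0.
- by move=> r /=; rewrite !in_itv/= => /andP[sr ->]; rewrite (le_trans s0 (ltW sr)).
Qed.

Lemma square_integral_triangle (D : set (measurableTypeR R)) (f h : R -> R) :
  measurable D -> measurable_fun D f -> measurable_fun D h ->
  (\int[mu]_(r in D) ((f r) ^+ 2)%:E <=
    2%:E * (\int[mu]_(r in D) ((f r - h r) ^+ 2)%:E) +
    2%:E * (\int[mu]_(r in D) ((h r) ^+ 2)%:E))%E.
Proof.
move=> mD mf mh.
have m1 : measurable_fun D (fun r => ((f r - h r) ^+ 2)%:E).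
  by apply/measurable_EFinP; apply: measurable_funX; exact: measurable_funB.
have m2 : measurable_fun D (fun r => ((h r) ^+ 2)%:E).
  by apply/measurable_EFinP; exact: measurable_funX.
rewrite -ge0_integralZl//; last by move=> r _; rewrite lee_fin sqr_ge0.
rewrite -ge0_integralZl//; last by move=> r _; rewrite lee_fin sqr_ge0.
rewrite -ge0_integralD//; first last.
- exact: measurable_funeM.
- by move=> r _; rewrite -EFinM lee_fin mulr_ge0 ?sqr_ge0.
- exact: measurable_funeM.
- by move=> r _; rewrite -EFinM lee_fin mulr_ge0 ?sqr_ge0.
apply: ge0_le_integral => //.
- by move=> r _; rewrite lee_fin sqr_ge0.
- by apply/measurable_EFinP; exact: measurable_funX.
- by apply: emeasurable_funD; exact: measurable_funeM.
- move=> r _; rewrite -!EFinM -EFinD lee_fin.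
  by have := sqr_ge0 (f r - 2 * h r); nra.
Qed.

(** Young's inequality with a free weight: it trades an expectation over an event
    of small probability against a small multiple of a second moment. *)
Lemma norm_mul_le_weighted (x y e : R) : 0 < e -> `|x * y| <= e * x ^+ 2 + y ^+ 2 / e.
Proof.
move=> e0; rewrite normrM -(ler_pM2l e0).
have -> : e * (e * x ^+ 2 + y ^+ 2 / e) = (e * `|x|) ^+ 2 + `|y| ^+ 2.
  by rewrite exprMn !real_normK ?num_real//; field; rewrite gt_eqF.
have := sqr_ge0 (e * `|x| - `|y|); have := normr_ge0 x; have := normr_ge0 y.
by have := sqr_ge0 (e * `|x|); have := sqr_ge0 `|y|; rewrite sqrrB; lra.
Qed.

(** The truncated increment [X] has mean 0 against [g], so only the distance from
    [X] to [I t - I s] matters.  Off the events [D] (bad uniform approximation),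
    [A] (bad approximation of the integrand) and [B] (large energy of the
    integrand) there is no truncation and the distance is small.  Off [D] it is
    bounded by about [2 * L], since [X] is close to an earlier increment of [I].
    On [D] the second moment of [X] is used. *)
Lemma bounded_ito_increment_mean0 (H I : R -> T -> R) (s t : R) (g : T -> R)
    (M L : R) :
  ito_integral F W H I -> (forall r : R, 0 <= r -> measurable_fun setT (I r)) ->
  0 <= s -> s < t ->
  (forall r w, s <= r -> r <= t -> `|I r w - I s w| <= L) ->
  measurable_wrt (F s) g -> (forall w, `|g w| <= M) ->
  Ex P (fun w => g w * (I t w - I s w)) = 0.
Proof.
move=> iI mI s0 st IL Fg gM.
have t0 : 0 < t by exact: le_lt_trans st.
have mg := measurable_wrt_filtration Fg.
have L0 : 0 <= L := le_trans (normr_ge0 _) (IL s point (lexx s) (ltW st)).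
have M0 : 0 <= M := le_trans (normr_ge0 _) (gM point).
have [_ mH Hfin _ _] := iI.
have mQ := square_integral_measurable t mH.
have mdI : measurable_fun setT (fun w => I t w - I s w).
  by apply: measurable_funB; apply: mI => //; exact: ltW.
have L2dI : L2 P (fun w => I t w - I s w).
  by apply: (@L2_bounded _ _ _ _ _ L mdI) => w; apply: IL => //; exact: ltW.
apply/eqP; rewrite -normr_le0; apply: (@le0_of_linear _ (6 * M)) => e e0.
have eL : 0 < e / (2 * L + 1) by rewrite divr_gt0//; lra.
have Lfin : {ae P, forall w,
    (\int[mu]_(r in `[0%R, t]) (H r w ^+ 2)%:E < +oo)%E}.
  by apply: filterS Hfin => w; apply; exact: ltW.
have [K' K'0 PB] := probability_tail_small mQ Lfin eL.
set B := [set w | _] in PB.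
have mB : measurable B.
  by rewrite -[X in measurable X]setTI; exact: emeasurable_fun_o_infty.
(* Off [A] and [B] the energy of the simple process is at most twice the squared
   distance to [H] plus twice the energy of [H], that is 2 * 1 + 2 * K'. *)
pose K := 2 + 2 * K'; have K0 : 0 < K by rewrite /K; lra.
pose eta := e / K; have eta0 : 0 < eta by rewrite divr_gt0.
have Leta : 0 < L + eta^-1 by rewrite ltr_wpDl// invr_gt0.
have ep : 0 < Num.min (e / (2 * L + 1)) (e / (L + eta^-1)).
  by rewrite lt_min eL divr_gt0.
have [S [D [A [mD mA PD PA [offD offA]]]]] :=
  ito_approximation BW iI mI t0 e0 ltr01 ep.
have {PD} PD : fine (P D) <= e / (L + eta^-1).
  by apply: fine_probability_le => //; apply: lt_le_trans PD _; rewrite lee_fin ge_min lexx orbT.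
have {PA} PA : fine (P A) <= e / (2 * L + 1).
  by apply: fine_probability_le => //; apply: lt_le_trans PA _; rewrite lee_fin ge_min lexx.
have {PB} PB : fine (P B) <= e / (2 * L + 1).
  by rewrite -lee_fin fineK ?fin_num_measure.
have [X [V [Q ci]]] := exists_controlled_increment BW S s0 st (ltW K0).
have QK w : ~ A w -> ~ B w -> Q w <= K.
  move=> nA nB; rewrite -lee_fin -(ci_energy ci).
  have mS : measurable_fun (`[0, t]%classic : set (measurableTypeR R))
      (fun r => simple_value S r w).
    by apply: measurable_funTS; exact: measurable_simple_value.
  apply: (le_trans (square_integral_le s0 mS)).
  have mHw := @joint_section_measurable _ _ _ H t w mH.
  apply: (le_trans (square_integral_triangle _ mS mHw)) => //.
  have -> : (K%:E = 2%:E * 1%:E + 2%:E * K'%:E)%E by rewrite -!EFinM -EFinD mulr1.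
  apply: leeD; apply: lee_wpmul2l => //; first exact: offA.
  by rewrite leNgt; apply/negP.
have L2X := ci_L2 ci; have mX := L2_measurable L2X.
have L2Y : L2 P (fun w => I t w - I s w - X w) by exact: L2B.
have L1gY : L1 P (fun w => g w * (I t w - I s w - X w)).
  exact/L2_L1/(L2_bounded_mul mg gM).
have <- : Ex P (fun w => g w * (I t w - I s w - X w)) =
    Ex P (fun w => g w * (I t w - I s w)).
  rewrite -[RHS]subr0 -(ci_mean0 ci Fg gM) -ExB.
  - by congr Ex; apply/funext => w; rewrite mulrBr.
  - exact/L2_L1/(L2_bounded_mul mg gM).
  - exact/L2_L1/(L2_bounded_mul mg gM).
pose Z w := 2 * e + (2 * L) * (\1_A w + \1_B w) +
  ((L + eta^-1) * \1_D w + eta * X w ^+ 2).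
have bound w : `|I t w - I s w - X w| <= Z w.
  have iA : 0 <= \1_A w :> R by rewrite indicE.
  have iB : 0 <= \1_B w :> R by rewrite indicE.
  have iD : 0 <= \1_D w :> R by rewrite indicE.
  have X2 : 0 <= eta * X w ^+ 2 by rewrite mulr_ge0 ?sqr_ge0// ltW.
  have It := IL t w (ltW st) (lexx t).
  have tri := ler_normB (I t w - I s w) (X w).
  have LA := mulr_ge0 L0 iA; have LB := mulr_ge0 L0 iB.
  have LD := mulr_ge0 (ltW Leta) iD.
  rewrite /Z; have [Dw|nD] := pselect (D w).
    have -> : \1_D w = 1 :> R by rewrite indicE mem_set.
    have := norm_mul_le_weighted (X w) 1 eta0; rewrite !mulr1 expr1n mul1r => yX.
    by lra.
  have [Q0|] := pselect (~ A w /\ ~ B w).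
    have Xw : X w = simple_integral W S t w - simple_integral W S s w.
      by apply: (ci_unstopped ci); apply: QK; tauto.
    have dt := offD w nD t (ltW t0) (lexx t); have ds := offD w nD s s0 (ltW st).
    have : `|I t w - I s w - X w| <= 2 * e.
      rewrite Xw (_ : _ - _ = (simple_integral W S s w - I s w) -
        (simple_integral W S t w - I t w)); last by ring.
      by apply: (le_trans (ler_normB _ _)); lra.
    by lra.
  move=> AB.
  have AB1 : 1 <= \1_A w + \1_B w :> R.
    have [Aw|nA] := pselect (A w).
      by rewrite (_ : \1_A w = 1 :> R) ?lerDl//; rewrite indicE mem_set.
    have [Bw|nB] := pselect (B w).
      by rewrite (_ : \1_B w = 1 :> R) ?lerDr//; rewrite indicE mem_set.
    by exfalso; apply: AB.
  (* Off [D], [X] is within [2 * e] of the increment of [I] up to the random time [r]. *)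
  have [r [sr rt Xr]] := ci_stopped ci w.
  have dr := offD w nD r (le_trans s0 sr) rt; have ds := offD w nD s s0 (ltW st).
  have Ir := IL r w sr rt.
  have : `|X w| <= L + 2 * e.
    rewrite Xr (_ : _ - _ = (I r w - I s w) + ((simple_integral W S r w - I r w) -
        (simple_integral W S s w - I s w))); last by ring.
    apply: (le_trans (ler_normD _ _)).
    by have := ler_normB (simple_integral W S r w - I r w) (simple_integral W S s w - I s w); lra.
  have := ler_wpM2l L0 AB1.
  by lra.
have lA := L1_indic P mA; have lB := L1_indic P mB; have lD := L1_indic P mD.
have lX2 := L2_sqr L2X.
have l12 : L1 P (fun w => 2 * e + (2 * L) * (\1_A w + \1_B w)).
  by apply: L1D; [exact: L1_cst|apply: L1Z; exact: L1D].
have l34 : L1 P (fun w => (L + eta^-1) * \1_D w + eta * X w ^+ 2).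
  by apply: L1D; exact: L1Z.
have EZ : Ex P Z <= 6 * e.
  have lAB : L1 P (fun w => (2 * L) * (\1_A w + \1_B w)).
    by apply: L1Z; exact: L1D.
  have eAB : Ex P (fun w => (2 * L) * (\1_A w + \1_B w)) =
      2 * L * (fine (P A) + fine (P B)).
    by rewrite (ExZ _ (L1D lA lB)) (ExD lA lB) !Ex_indic.
  rewrite /Z (ExD l12 l34) (ExD (L1_cst P (2 * e)) lAB).
  rewrite (ExD (L1Z _ lD) (L1Z _ lX2)) (ExZ _ lD) (ExZ _ lX2) eAB Ex_cst Ex_indic//.
  have h1 : (2 * L) * (fine (P A) + fine (P B)) <= 2 * e.
    have : (2 * L + 1) * (fine (P A) + fine (P B)) <= 2 * e.
      rewrite mulrC -ler_pdivlMr; last lra.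
      by rewrite -mulrA; set x := e / _ in PA PB *; lra.
    have : 0 <= fine (P A) by exact: fine_ge0.
    have : 0 <= fine (P B) by exact: fine_ge0.
    by nra.
  have h2 : (L + eta^-1) * fine (P D) <= e by rewrite mulrC -ler_pdivlMr.
  have h3 : eta * Ex P (fun w => X w ^+ 2) <= e.
    apply: (@le_trans _ _ (eta * K)); first by rewrite ler_pM2l// (ci_sqr ci).
    by rewrite /eta divfK// gt_eqF.
  by lra.
apply: (le_trans (Ex_norm L1gY)).
apply: (@le_trans _ _ (Ex P (fun w => M * Z w))).
  apply: Ex_le; [exact: L1_norm|by apply: L1Z; exact: L1D|].
  by move=> w; rewrite normrM ler_pM.
rewrite ExZ; last exact: L1D.
by rewrite mulrAC [leRHS]mulrC ler_wpM2l// mulrC.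
Qed.

End bounded_ito_integrals.

(** * Ito integrals with constant paths *)

Section constant_ito_integrals.
Context d (T : measurableType d) {R : realType} (P : probability T R).
Variable W : R -> {RV P >-> R}.
Local Notation F := (brownian_filtration W).
Local Notation mu := (@lebesgue_measure R).
Hypothesis BW : brownian_motion W.

(** On the part where [H s] is at most [m] the energy over [[s, t]] is bounded, so
    truncation does not occur there except on a small event.  The covariation of
    [X] with [W] is small because [X] is, while it is at least about
    [(t - s) * E (g * H s)], where [g] is the indicator of that part. *)
Lemma constant_ito_bounded_part (H I : R -> T -> R) (s t m : R) :
  ito_integral F W H I -> (forall r : R, 0 <= r -> measurable_fun setT (I r)) ->
  0 <= s -> s < t -> (forall w, 0 <= H s w) -> 0 <= m ->
  {ae P, forall w, forall r, s <= r -> r <= t ->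
     I r w = I s w /\ H r w = H s w} ->
  Ex P (fun w => \1_(H s @^-1` `]-oo, m]) w * H s w) <= 0.
Proof.
move=> iI mI s0 st H0 m0 cst_ae.
have t0 : 0 < t by exact: le_lt_trans st.
have ts : 0 < t - s by rewrite subr_gt0.
have [aH mH _ _ _] := iI.
have FH := aH s s0; have mHs := measurable_wrt_filtration FH.
pose E := H s @^-1` `]-oo, m]; pose g : T -> R := \1_E.
have Fg : measurable_wrt (F s) g.
  exact: (measurable_wrt_comp (measurable_indic (measurable_itv `]-oo, m])) FH).
have mg := measurable_wrt_filtration Fg.
have g1 w : `|g w| <= 1 by rewrite /g indicE; case: (_ \in _); rewrite ?normr1 ?normr0.
pose h w := g w * H s w.
have hb w : 0 <= h w <= m.
  rewrite /h /g indicE; case: (boolP (w \in E)) => [|_]; last by rewrite mul0r lexx.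
  by rewrite inE /E/= in_itv/= mul1r H0.
have lh : L1 P h.
  apply: (@L1_bounded _ _ _ _ _ m); first exact: measurable_funM.
  by move=> w; have /andP[h0 hm] := hb w; rewrite ger0_norm.
rewrite -(pmulr_rle0 (Ex P h) ts).
have [L2dW _ EdW2] := increment_moments BW s0 (ltW st).
set dW := (fun w => W t w - W s w) in L2dW.
have lW2 : L1 P (fun w => dW w ^+ 2) := L2_sqr L2dW.
(* The energy of the constant [m] over [[s, t]] is [m ^+ 2 * (t - s)]; the squared
   distance to the simple process is at most [e2 <= 1]. *)
pose K := 2 + 2 * m ^+ 2 * (t - s).
have K0 : 0 <= K by rewrite /K addr_ge0// mulr_ge0 ?(ltW ts)// mulr_ge0// sqr_ge0.
pose c := (t - s) + K + (t - s) * m.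
have c0 : 0 < c by rewrite /c; have := mulr_ge0 (ltW ts) m0; lra.
apply: (@le0_of_linear _ _ (2 * (1 + (t - s)) + K + 3 + (t - s))) => e e0.
have ee0 : 0 < e ^+ 2 by rewrite exprn_gt0.
have [rho rho0 small] := Ex_small_on_small_event lW2 ee0.
pose e2 := Num.min 1 (e ^+ 2).
have e20 : 0 < e2 by rewrite lt_min ltr01.
have ep : 0 < Num.min rho (e / c) by rewrite lt_min rho0 divr_gt0.
have [S [D [A [mD mA PD PA [offD offA]]]]] :=
  ito_approximation BW iI mI t0 e0 e20 ep.
have {small PD} smallD : Ex P (fun w => `|dW w ^+ 2| * \1_D w) <= e ^+ 2.
  apply: small => //; apply: lt_le_trans PD _.
  by rewrite lee_fin ge_min lexx.
have {PA} PA : fine (P A) <= e / c.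
  by apply: fine_probability_le => //; apply: lt_le_trans PA _; rewrite lee_fin ge_min lexx orbT.
have [X [V [Q ci]]] := exists_controlled_increment BW S s0 st K0.
have L2X := ci_L2 ci; have mX := L2_measurable L2X; have lX2 := L2_sqr L2X.
have mV := ci_drift_measurable ci.
have mS w : measurable_fun (`[0, t]%classic : set (measurableTypeR R))
      (fun r => simple_value S r w).
  by apply: measurable_funTS; exact: measurable_simple_value.
have lgV : L1 P (fun w => g w * V w).
  apply: L2_L1; apply: (L2_bounded_mul mg g1).
  exact: L2_bounded mV (ci_drift_bounded ci).
have lA := L1_indic P mA; have lD := L1_indic P mD.
(* Off [A] the simple process is close to the constant [H s] in mean square, so its
   integral is at least [(t - s) * H s] up to an error; on [A] the crude bound on [V]
   costs the constant [c]. *)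
have low : {ae P, forall w,
    (t - s) * h w <= g w * V w + ((t - s) * e + e + c * \1_A w)}.
  apply: filterS cst_ae => w Iw.
  have iA : 0 <= \1_A w :> R by rewrite indicE.
  have LA := mulr_ge0 (ltW c0) iA.
  have LE := mulr_ge0 (ltW ts) (ltW e0).
  rewrite /h /g [\1_E w]indicE; case: (boolP (w \in E)) => [|_]; last by rewrite !mul0r mulr0; lra.
  rewrite inE /E/= in_itv/= !mul1r => Hm.
  have [Aw|nA] := pselect (A w).
    have -> : \1_A w = 1 :> R by rewrite indicE mem_set.
    have := ci_drift_bounded ci w; rewrite ler_norml => /andP[V1 _].
    have := ler_wpM2l (ltW ts) Hm.
    by rewrite mulr1 /c; lra.
  have en : (\int[mu]_(r in `]s, t]) ((simple_value S r w - H s w) ^+ 2)%:E <= e2%:E)%E.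
    apply: le_trans (offA w nA).
    apply: (@le_trans _ _ (\int[mu]_(r in `]s, t])
        ((simple_value S r w - H r w) ^+ 2)%:E)%E).
      rewrite le_eqVlt; apply/orP; left; apply/eqP.
      apply: eq_integral => r; rewrite inE/= in_itv/= => /andP[sr rt].
      by rewrite (Iw r (ltW sr) rt).2.
    apply: (square_integral_le s0); apply: measurable_funB => //.
    exact: (@joint_section_measurable _ _ _ H t w mH).
  have Qw : Q w <= K.
    rewrite -lee_fin -(ci_energy ci).
    have m1 : measurable_fun (`]s, t]%classic : set (measurableTypeR R))
      (fun r => simple_value S r w).
      by apply: measurable_funTS; exact: measurable_simple_value.
    have mI' : measurable (`]s, t]%classic : set (measurableTypeR R)).
      exact: measurable_itv.
    apply: (le_trans (square_integral_triangle mI' m1 (measurable_cst (H s w)))).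
    rewrite /= integral_cst//= lebesgue_measure_itv/= lte_fin st -EFinD -!EFinM.
    have -> : (K%:E = 2%:E * 1%:E + (2 * (m ^+ 2 * (t - s)))%:E)%E.
      by rewrite -!EFinM -EFinD mulr1 mulrA.
    apply: leeD; last first.
      rewrite lee_fin ler_wpM2l// ler_wpM2r ?(ltW ts)//.
      by rewrite lerXn2r ?nnegrE.
    apply: lee_wpmul2l => //; apply: (le_trans en).
    by rewrite lee_fin ge_min lexx.
  have := ci_drift_ge ci Qw e0 en.
  have : e2 / e <= e.
    rewrite ler_pdivrMr// -expr2; by rewrite ge_min lexx orbT.
  by rewrite mulrBr; lra.
(* Off [D], [X] is within [2 * e] of an increment of [I], and these vanish. *)
have up : {ae P, forall w, g w * X w * dW w <=
    2 * e * (1 + dW w ^+ 2) + (e * X w ^+ 2 + e^-1 * (`|dW w ^+ 2| * \1_D w))}.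
  apply: filterS cst_ae => w Iw.
  have iD : 0 <= \1_D w :> R by rewrite indicE.
  have X2 : 0 <= e * X w ^+ 2 by rewrite mulr_ge0 ?sqr_ge0// ltW.
  have W2 : 0 <= dW w ^+ 2 by exact: sqr_ge0.
  have eW2 := mulr_ge0 (ltW e0) W2.
  have b0 : g w * X w * dW w <= `|X w * dW w|.
    rewrite -mulrA (le_trans (ler_norm _))// normrM.
    by rewrite -[leRHS]mul1r ler_wpM2r.
  apply: (le_trans b0); rewrite (ger0_norm W2).
  have [Dw|nD] := pselect (D w).
    have -> : \1_D w = 1 :> R by rewrite indicE mem_set.
    by have := norm_mul_le_weighted (X w) (dW w) e0; rewrite mulr1 [_ / e]mulrC; lra.
  have [r [sr rt Xr]] := ci_stopped ci w.
  have Xe : `|X w| <= 2 * e.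
    have dr := offD w nD r (le_trans s0 sr) rt; have ds := offD w nD s s0 (ltW st).
    rewrite Xr (_ : _ - _ = (simple_integral W S r w - I r w) -
        (simple_integral W S s w - I s w)); last by rewrite (Iw r sr rt).1; ring.
    by have := ler_normB (simple_integral W S r w - I r w) (simple_integral W S s w - I s w); lra.
  have W1 : `|dW w| <= 1 + dW w ^+ 2.
    by have := norm_mul_le_weighted 1 (dW w) ltr01; rewrite mul1r expr1n mulr1 divr1.
  have D0 : 0 <= e^-1 * (dW w ^+ 2 * \1_D w).
    by apply: mulr_ge0; [rewrite invr_ge0 ltW|exact: mulr_ge0].
  have : `|X w * dW w| <= 2 * e * (1 + dW w ^+ 2) by rewrite normrM ler_pM.
  by lra.
have lup1 : L1 P (fun w => 2 * e * (1 + dW w ^+ 2)).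
  by apply: L1Z; apply: L1D => //; exact: L1_cst.
have lWD : L1 P (fun w => `|dW w ^+ 2| * \1_D w).
  apply: (L1_le _ _ lW2).
    apply: measurable_funM => //; apply: measurableT_comp => //.
    exact: L1_measurable lW2.
  move=> w; rewrite normrM normr_id [`|dW w ^+ 2|]ger0_norm ?sqr_ge0//.
  rewrite -[leRHS]mulr1 ler_wpM2l ?sqr_ge0//.
  by rewrite indicE; case: (_ \in _); rewrite ?normr1 ?normr0.
have lup2 : L1 P (fun w => e * X w ^+ 2 + e^-1 * (`|dW w ^+ 2| * \1_D w)).
  by apply: L1D; exact: L1Z.
have lgXW : L1 P (fun w => g w * X w * dW w).
  by apply: L2M => //; exact: (L2_bounded_mul mg g1).
have Eup := Ex_le_ae lgXW (L1D lup1 lup2) up.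
have llow : L1 P (fun w => (t - s) * e + e + c * \1_A w).
  by apply: L1D; [exact: L1_cst|exact: L1Z].
have Elow := Ex_le_ae (L1Z (t - s) lh) (L1D lgV llow) low.
have EcstA : Ex P (fun w => (t - s) * e + e + c * \1_A w) =
    (t - s) * e + e + c * fine (P A).
  by rewrite (ExD (L1_cst P ((t - s) * e + e)) (L1Z _ lA)) Ex_cst (ExZ _ lA) Ex_indic.
have Eup1 : Ex P (fun w => 2 * e * (1 + dW w ^+ 2)) = 2 * e * (1 + (t - s)).
  by rewrite (ExZ _ (L1D (L1_cst P 1) lW2)) (ExD (L1_cst P 1) lW2) Ex_cst EdW2.
have Eup2 : Ex P (fun w => e * X w ^+ 2 + e^-1 * (`|dW w ^+ 2| * \1_D w)) <=
    e * K + e.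
  rewrite (ExD (L1Z _ lX2) (L1Z _ lWD)) (ExZ _ lX2) (ExZ _ lWD); apply: lerD.
    by rewrite ler_pM2l// (ci_sqr ci).
  by rewrite mulrC ler_pdivrMr// -expr2.
have cov := ci_covariation ci Fg g1.
have cA : c * fine (P A) <= e by rewrite mulrC -ler_pdivlMr.
rewrite (ExZ _ lh) (ExD lgV llow) EcstA in Elow.
rewrite (ExD lup1 lup2) Eup1 in Eup.
by rewrite -cov in Elow; lra.
Qed.

Lemma constant_ito_integrand0 (H I : R -> T -> R) (s t : R) :
  ito_integral F W H I -> (forall r : R, 0 <= r -> measurable_fun setT (I r)) ->
  0 <= s -> s < t -> (forall w, 0 <= H s w) ->
  {ae P, forall w, forall r, s <= r -> r <= t ->
     I r w = I s w /\ H r w = H s w} ->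
  {ae P, forall w, H s w = 0}.
Proof.
move=> iI mI s0 st H0 cst_ae.
have [aH _ _ _ _] := iI; have mHs := measurable_wrt_filtration (aH s s0).
have part (n : nat) : {ae P, forall w,
    \1_(H s @^-1` `]-oo, n%:R]) w * H s w = 0}.
  apply: Ex_eq0_ae.
  - apply: (@L1_bounded _ _ _ _ _ n%:R).
      apply: measurable_funM => //; apply: measurable_indic.
      by rewrite -[X in measurable X]setTI; exact: mHs.
    move=> w; rewrite indicE; case: (boolP (w \in _)) => [|_]; last by rewrite mul0r normr0.
    by rewrite inE/= in_itv/= mul1r ger0_norm.
  - by move=> w; rewrite mulr_ge0// indicE.
  - exact: (constant_ito_bounded_part iI mI s0 st H0 (ler0n R n) cst_ae).
have := ae_foralln part; apply: filterS => w hw.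
have := hw (Num.truncn (H s w)).+1; rewrite indicE mem_set ?mul1r//=.
by rewrite in_itv/= ltW// truncnS_gt.
Qed.

End constant_ito_integrals.

(** * Growth of the variance *)

Section variance_growth.
Context d (T : measurableType d) {R : realType} (P : probability T R).
Variables (a b z : R) (sigma : R -> R) (W Z : R -> {RV P >-> R}).
Local Notation F := (brownian_filtration W).
Hypothesis sigma_a : sigma a = 0.
Hypothesis sigma_b : sigma b = 0.
Hypothesis sigma_gt0 : forall x : R, x \in `]a, b[ -> 0 < sigma x.
Hypothesis BW : brownian_motion W.
Hypothesis solution : absorbed_strong_solution W a b sigma z Z.

Let Z_bounds (r : R) w : 0 <= r -> a <= Z r w <= b.
Proof. by have [Zab _ _ _ _] := solution; move/Zab => /(_ w); rewrite in_itv. Qed.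

Let Z_wrt (r : R) : 0 <= r -> measurable_wrt (F r) (Z r).
Proof. by have [_ _ [_ aZ] _ _] := solution; exact: aZ. Qed.

Let Z_norm (r : R) w : 0 <= r -> `|Z r w| <= `|a| + `|b|.
Proof.
move=> r0; have /andP[aZ Zb] := Z_bounds w r0; rewrite ler_norml; apply/andP; split.
  by have := ler_norm (- a); rewrite normrN; have := normr_ge0 b; lra.
by have := ler_norm b; have := normr_ge0 a; lra.
Qed.

Let Z_L2 (r : R) : 0 <= r -> L2 P (Z r).
Proof. by move=> r0; apply: L2_bounded => // w; exact: Z_norm. Qed.

Let martingale (s t M : R) (g : T -> R) : 0 <= s -> s < t ->
  measurable_wrt (F s) g -> (forall w, `|g w| <= M) ->
  Ex P (fun w => g w * (Z t w - Z s w)) = 0.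
Proof.
move=> s0 st Fg gM; have [_ _ _ iI _] := solution.
rewrite -[RHS](@bounded_ito_increment_mean0 _ _ _ P W BW _ _ s t g M (b - a) iI)//.
- by congr Ex; apply/funext => w; ring.
- by move=> r r0; exact: measurable_funB.
- move=> r w sr rt; have r0 := le_trans s0 sr.
  have /andP[] := Z_bounds w r0; have /andP[] := Z_bounds w s0.
  by move=> *; rewrite ler_norml; apply/andP; split; lra.
Qed.

Let gap (s t : R) := Ex P (fun w => (Z t w - Z s w) ^+ 2).

(** Means are constant and increments are orthogonal to the past. *)
Let variance_gap (s t : R) : 0 <= s -> s < t ->
  ('V_P[Z t] = 'V_P[Z s] + (gap s t)%:E)%E.
Proof.
move=> s0 st; have t0 : 0 <= t by rewrite ltW// (le_lt_trans s0).
have ls := Z_L2 s0; have lt := Z_L2 t0; have ld := L2B lt ls.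
rewrite (varianceEx ls) (varianceEx lt) -EFinD; congr EFin.
have m1 : Ex P (Z t) = Ex P (Z s).
  apply/eqP; rewrite -subr_eq0 -(ExB (L2_L1 lt) (L2_L1 ls)).
  rewrite -(@martingale s t 1 (cst 1) s0 st).
  - by apply/eqP; congr Ex; apply/funext => w; rewrite mul1r.
  - exact: measurable_wrt_cst.
  - by move=> w; rewrite normr1.
have m2 := martingale s0 st (Z_wrt s0) (fun w => Z_norm w s0).
have m3 : Ex P (fun w => Z t w ^+ 2) = Ex P (fun w => Z s w ^+ 2) + gap s t +
    2 * Ex P (fun w => Z s w * (Z t w - Z s w)).
  rewrite -(ExZ _ (L2M ls ld)) /gap -(ExD (L2_sqr ls) (L2_sqr ld)).
  rewrite -(ExD (L1D (L2_sqr ls) (L2_sqr ld)) (L1Z _ (L2M ls ld))).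
  by congr Ex; apply/funext => w; ring.
by rewrite m1 m3 m2; ring.
Qed.

(** Increments over successive intervals are orthogonal, so their mean squares add. *)
Let gap_split (s r t : R) : 0 <= s -> s <= r -> r < t -> gap s r <= gap s t.
Proof.
move=> s0 sr rt; have r0 := le_trans s0 sr.
have t0 : 0 <= t by rewrite ltW// (le_lt_trans r0).
have l1 := L2B (Z_L2 r0) (Z_L2 s0); have l2 := L2B (Z_L2 t0) (Z_L2 r0).
have m : Ex P (fun w => (Z r w - Z s w) * (Z t w - Z r w)) = 0.
  apply: (@martingale r t ((`|a| + `|b|) + (`|a| + `|b|))) => //.
    apply: measurable_wrtB; first exact: Z_wrt.
    by apply: measurable_wrtS (Z_wrt s0); exact: filtration_mono.
  move=> w; apply: (le_trans (ler_normB _ _)).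
  by apply: lerD; exact: Z_norm.
have -> : gap s t = gap s r + gap r t + 2 * Ex P (fun w => (Z r w - Z s w) * (Z t w - Z r w)).
  rewrite /gap -(ExD (L2_sqr l1) (L2_sqr l2)) -(ExZ _ (L2M l1 l2)).
  rewrite -(ExD (L1D (L2_sqr l1) (L2_sqr l2)) (L1Z _ (L2M l1 l2))).
  by congr Ex; apply/funext => w; ring.
rewrite m mulr0 addr0 lerDl; apply: Ex_ge0 => w; exact: sqr_ge0.
Qed.

(** Equality at each rational time holds almost surely, hence at all rational times
    simultaneously, and continuity extends it to all times. *)
Lemma constant_paths (s t : R) : 0 <= s -> s < t -> gap s t <= 0 ->
  {ae P, forall w, forall r, s <= r -> r <= t -> Z r w = Z s w}.
Proof.
move=> s0 st gap0.
have at_time r : s <= r -> r <= t -> {ae P, forall w, Z r w = Z s w}.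
  move=> sr rt; have r0 := le_trans s0 sr.
  have : gap s r <= 0.
    move: rt; rewrite le_eqVlt => /predU1P[->//|rt].
    exact: le_trans (gap_split s0 sr rt) gap0.
  move/(Ex_eq0_ae (L2_sqr (L2B (Z_L2 r0) (Z_L2 s0)))) => h.
  apply: filterS (h (fun w => sqr_ge0 _)) => w /eqP.
  by rewrite sqrf_eq0 subr_eq0 => /eqP.
have rational : {ae P, forall w, forall n : nat, forall q : rat,
    unpickle n = Some q -> s <= ratr q -> ratr q <= t -> Z (ratr q) w = Z s w}.
  apply/ae_foralln => n; case E : (unpickle n : option rat) => [q|]; last first.
    by apply: aeW => w q.
  have [sq|qs] := leP s (ratr q); last first.
    by apply: aeW => w q' [<-]; rewrite leNgt qs.
  have [qt|tq] := leP (ratr q) t; last first.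
    by apply: aeW => w q' [<-] _; rewrite leNgt tq.
  by apply: filterS (at_time _ sq qt) => w Zw q' [<-].
apply: filterS rational => w Zq r sr rt.
have r0 := le_trans s0 sr.
have [_ _ [cZ _] _ _] := solution.
have /subspace_continuousP/(_ r) := cZ w.
rewrite /= in_itv/= r0 => /(_ isT) cZr.
apply/eqP; rewrite -subr_eq0 -normr_le0 leNgt; apply/negP => Zrs.
move/cvgrPdist_lt : cZr => /(_ _ Zrs) [dl /= dl0 hd].
have : Num.max s (r - dl) < Num.min t (r + dl).
  by rewrite lt_min !gt_max st/=; apply/and3P; split; lra.
move=> /rat_in_itvoo[q]; rewrite in_itv/= gt_max lt_min => /andP[/andP[sq rq] /andP[qt qr]].
have : `|Z r w - Z (ratr q) w| < `|Z r w - Z s w|.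
  apply: hd; last by rewrite /= in_itv/= andbT (le_trans s0)// ltW.
  by rewrite /= ltr_norml; apply/andP; split; lra.
by rewrite (Zq (pickle q) q (pickleK q) (ltW sq) (ltW qt)) ltxx.
Qed.

(** A vanishing increment of the variance makes the paths constant on [[s, t]]; then
    the integrand [sigma (Z s)] vanishes almost surely, which places [Z s] at an
    end point. *)
Lemma variance_increasing (s t : R) : 0 <= s -> s < t ->
  (P (Z s @^-1` [set a; b]) < 1)%E -> ('V_P[Z s] < 'V_P[Z t])%E.
Proof.
move=> s0 st Pab; rewrite (variance_gap s0 st).
rewrite lteDl ?(varianceEx (Z_L2 s0))// lte_fin ltNge; apply/negP => gap0.
have sigma_ge0 w : 0 <= sigma (Z s w).
  have /andP[] := Z_bounds w s0; rewrite le_eqVlt => /predU1P[<-|aZ].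
    by rewrite sigma_a.
  rewrite le_eqVlt => /predU1P[->|Zb]; first by rewrite sigma_b.
  by rewrite ltW// sigma_gt0// in_itv/= aZ.
have [_ _ _ iI _] := solution.
have sigma0 : {ae P, forall w, sigma (Z s w) = 0}.
  apply: (constant_ito_integrand0 BW iI _ s0 st sigma_ge0).
    by move=> r r0; exact: measurable_funB.
  apply: filterS (constant_paths s0 st gap0) => w Zw r sr rt.
  by rewrite (Zw r sr rt).
have mab : measurable (Z s @^-1` [set a; b]).
  rewrite -[X in measurable X]setTI; apply: measurable_funPT => //.
  by apply: measurableU; exact: measurable_set1.
suff PT : P (Z s @^-1` [set a; b]) = 1%E by rewrite PT ltxx in Pab.
apply: Ex_probability1 => //; apply: filterS sigma0 => w s0w /=.
have /andP[] := Z_bounds w s0; rewrite le_eqVlt => /predU1P[->|aZ]; first by left.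
rewrite le_eqVlt => /predU1P[->|Zb]; first by right.
have : 0 < sigma (Z s w) by apply: sigma_gt0; rewrite in_itv/= aZ.
by rewrite s0w ltxx.
Qed.

End variance_growth.

Theorem proposition2 (R : realType) (a b z : R) (hab : a < b)
    (hz : z \in `[a, b]) :
  (argmax (laws_with_mean a b z) (fun L => 'V_L[idfun])
       (generalized_bernoulli a b z) /\
   forall L : probability R R,
     argmax (laws_with_mean a b z) (fun L' => 'V_L'[idfun]) L ->
     forall A : set R, measurable A -> L A = generalized_bernoulli a b z A)
  /\
  (forall (sigma : R -> R) (d : measure_display) (T : measurableType d)
      (P : probability T R) (W Z : R -> {RV P >-> R}),
    sigma a = 0 -> sigma b = 0 ->
    (forall x : R, x \in `]a, b[ -> 0 < sigma x) ->
    locally_holder_half a b sigma ->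
    brownian_motion W ->
    absorbed_strong_solution W a b sigma z Z ->
    forall s t : R, 0 <= s -> s < t ->
      (P (Z s @^-1` [set a; b]) < 1)%E -> ('V_P[Z s] < 'V_P[Z t])%E).
Proof.
split; first exact: max_variance_law.
move=> sigma d T P W Z sa sb spos _ BW sol s t s0 st.
exact: (variance_increasing sa sb spos BW sol).
Qed.
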